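(* Let $p\in(0,1]$ and $(\gamma'+\pi)/2\in J_\gamma\setminus J_{\gamma,\mathcal{T}}$. Let $\mathbf{e}=\bigcup_{j=1}^N\{y_j-1,y_j\}$ with $y_1,\dots,y_N\in\mathbf{Z}$, where $N\ge0$ is an integer ($N=0$ meaning $\mathbf{e}=\emptyset$), and let $U=SC$ with $C=F_{\mathbf{e}}C_1+(1-F_{\mathbf{e}})C_2$, where the position-dependent coin $C_2$ is such that there exist $\rho,M>0$ with $\|C_2(x)-C_0\|_\infty\le Me^{-\rho\langle x\rangle}$ for all $x\in\mathbf{Z}$, and there exists $\delta>0$ with $|a_2(x)|\ge\delta$ for all $x\in\mathbf{Z}$. Then there is no edge defect, i.e. $\mathbf{e}=\emptyset$, if and only if $U$ has no eigenvalue in $\sigma_{ess}(U)\setminus\mathcal{T}$.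
   Context: Let $\mathcal{H}=\ell^2(\mathbf{Z};\mathbf{C}^2)$, with elements $\psi(x)=(\psi^{(0)}(x),\psi^{(1)}(x))^T$. The shift $S$ is $(S\psi)(x)=(\psi^{(0)}(x+1),\psi^{(1)}(x-1))^T$. For $A\subset\mathbf{Z}$, $F_A$ is the operator $(F_A\psi)(x)=\psi(x)$ for $x\in A$ and $0$ for $x\notin A$. Coin operators act by pointwise matrix multiplication. The constant coin $C_0$ is $$C_0=\begin{bmatrix} pe^{i\alpha} & qe^{i\beta}\\ -qe^{-i(\beta-\gamma)} & pe^{-i(\alpha-\gamma)}\end{bmatrix},\qquad \alpha,\beta,\gamma\in[0,2\pi),\ p,q\in[0,1],\ p^2+q^2=1.$$ The constant coin $C_1$ is $$C_1=e^{i\gamma'/2}\begin{bmatrix}0&e^{i(\beta'-\gamma'/2)}\\-e^{-i(\beta'-\gamma'/2)}&0\end{bmatrix},\qquad \beta',\gamma'\in[0,2\pi).$$ The coin $C_2$ is $C_2(x)=\begin{bmatrix}a_2(x)&b_2(x)\\c_2(x)&d_2(x)\end{bmatrix}\in U(2)$ for $x\in\mathbf{Z}$. $\|A\|_\infty=\max_{j,k}|a_{jk}|$ for a $2\times2$ matrix, $\langle x\rangle=\sqrt{1+x^2}$. Define $J_\gamma=[\arccos p+\gamma/2,\pi-\arccos p+\gamma/2]\cup[\pi+\arccos p+\gamma/2,2\pi-\arccos p+\gamma/2]$, $J_{\gamma,\mathcal{T}}=\{\arccos p+\gamma/2,\ \pi-\arccos p+\gamma/2,\ \pi+\arccos p+\gamma/2,\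 2\pi-\arccos p+\gamma/2\}$, and $\mathcal{T}=\{e^{i\theta}\in\sigma_{ess}(U) : \theta\in J_{\gamma,\mathcal{T}}\}$. $\sigma_{ess}(U)=\sigma(U)\setminus\sigma_d(U)$, where $\sigma_d(U)$ is the set of isolated points of $\sigma(U)$ that are eigenvalues of finite multiplicity; eigenvalues are with respect to eigenfunctions in $\mathcal{H}$. *)

(* Defs.v *)
From HB Require Import structures.
From mathcomp Require Import all_boot all_order all_algebra.
From mathcomp Require Import complex.
From mathcomp Require Import all_classical all_reals all_analysis.
From mathcomp Require Import ring lra.

Set Implicit Arguments.
Unset Strict Implicit.
Unset Printing Implicit Defensive.

Import Order.TTheory GRing.Theory Num.Theory.
Import numFieldNormedType.Exports.

Local Open Scope classical_set_scope.
Local Open Scope ring_scope.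
Local Open Scope complex_scope.

Section spectral_theory.
Context {K : numFieldType} {V : normedModType K}.
Implicit Types (T : {linear V -> V}) (lambda : K).

(* For a linear G, continuity is boundedness: T - lambda has a bounded
   two-sided inverse. *)
Definition in_resolvent T lambda : Prop :=
  exists G : {linear V -> V},
    [/\ continuous G,
        forall v, G (T v - lambda *: v) = v &
        forall v, T (G v) - lambda *: G v = v].

Definition spectrum T : set K := [set lambda | ~ in_resolvent T lambda].

Definition is_eigenvalue T lambda : Prop :=
  exists2 v : V, v != 0 & T v = lambda *: v.

Definition finite_multiplicity T lambda : Prop :=
  exists (n : nat) (b : 'I_n -> V), forall v, T v = lambda *: v ->
    exists c : 'I_n -> K, v = \sum_i c i *: b i.

Definition disc_spectrum T : set K :=
  [set lambda | [/\ isolated (spectrum T) lambda, is_eigenvalue T lambda &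
                    finite_multiplicity T lambda]].

Definition ess_spectrum T : set K := spectrum T `\` disc_spectrum T.

End spectral_theory.

Section ell2.
Context {R : realType}.
Implicit Types (psi phi : int -> 'cV[R[i]]_2) (v w : 'cV[R[i]]_2).

Definition sqnormC2 v : R :=
  Normc.normc (v 0 0) ^+ 2 + Normc.normc (v 1 0) ^+ 2.

Definition ell2_sqnorm psi : \bar R :=
  (\esum_(x in [set: int]) (sqnormC2 (psi x))%:E)%E.

Definition ell2 : {pred int -> 'cV[R[i]]_2} :=
  mem [set psi | (ell2_sqnorm psi < +oo)%E].

Lemma sqnormC2_ge0 v : 0 <= sqnormC2 v.
Proof. by rewrite addr_ge0// sqr_ge0. Qed.

Lemma sqnormC2Z (a : R[i]) v :
  sqnormC2 (a *: v) = Normc.normc a ^+ 2 * sqnormC2 v.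
Proof. by rewrite /sqnormC2 !mxE !Normc.normcM; ring. Qed.

Lemma normc_ge0 (a : R[i]) : 0 <= Normc.normc a.
Proof. by case: a => a b; exact: sqrtr_ge0. Qed.

Lemma sqnormC2_eq0 v : sqnormC2 v = 0 -> v = 0.
Proof.
move=> /eqP; rewrite paddr_eq0 ?sqr_ge0// !sqrf_eq0 => /andP[/eqP v0 /eqP v1].
apply/matrixP => i j; rewrite (ord1 j) mxE.
have /orP[/eqP->|/eqP->] : (i == 0) || (i == 1) by case: i => -[|[|]].
- exact: Normc.eq0_normc.
- exact: Normc.eq0_normc.
Qed.

Lemma sqnormC2D (t : R) v w : 0 < t ->
  sqnormC2 (v + w) <= (1 + t) * sqnormC2 v + (1 + t^-1) * sqnormC2 w.
Proof.
move=> t0.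
have key (a b : R[i]) : Normc.normc (a + b) ^+ 2 <=
    (1 + t) * Normc.normc a ^+ 2 + (1 + t^-1) * Normc.normc b ^+ 2.
  have ab : Normc.normc (a + b) <= Normc.normc a + Normc.normc b.
    exact: le_normcD.
  apply: (@le_trans _ _ ((Normc.normc a + Normc.normc b) ^+ 2)).
    by rewrite ler_sqr ?nnegrE ?addr_ge0 ?normc_ge0.
  rewrite -subr_ge0; set x := Normc.normc a; set y := Normc.normc b.
  have -> : (1 + t) * x ^+ 2 + (1 + t^-1) * y ^+ 2 - (x + y) ^+ 2 =
            t^-1 * (t * x - y) ^+ 2 by field; rewrite gt_eqF.
  by rewrite mulr_ge0 ?sqr_ge0// invr_ge0 ltW.
rewrite /sqnormC2 !mxE.
apply: (le_trans (lerD (key _ _) (key _ _))).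
by rewrite le_eqVlt; apply/orP; left; apply/eqP; ring.
Qed.

Lemma ell2_sqnorm_ge0 psi : (0 <= ell2_sqnorm psi)%E.
Proof. by apply: esum_ge0 => x _; rewrite lee_fin sqnormC2_ge0. Qed.

Lemma esumZ (c : R) (f : int -> R) : 0 <= c -> (forall x, 0 <= f x) ->
  (\esum_(x in [set: int]) (c * f x)%:E <=
   c%:E * \esum_(x in [set: int]) (f x)%:E)%E.
Proof.
move=> c0 f0; apply: ge_ereal_sup => _ [A [finA _]] <-.
under eq_fsbigr do rewrite EFinM.
rewrite -ge0_mule_fsumr; last by move=> x; rewrite lee_fin.
apply: lee_wpmul2l; first by rewrite lee_fin.
by apply: esum_ge; exists A.
Qed.

Lemma ell2_sqnormD (t : R) psi phi : 0 < t ->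
  (ell2_sqnorm (psi + phi)%R <=
   (1 + t)%:E * ell2_sqnorm psi + (1 + t^-1)%:E * ell2_sqnorm phi)%E.
Proof.
move=> t0.
have t1 : 0 <= 1 + t by rewrite addr_ge0// ltW.
have t2 : 0 <= 1 + t^-1 by rewrite addr_ge0// invr_ge0 ltW.
apply: (@le_trans _ _ (\esum_(x in [set: int])
    (((1 + t) * sqnormC2 (psi x))%:E + ((1 + t^-1) * sqnormC2 (phi x))%:E))%E).
  by apply: le_esum => x _; rewrite -EFinD lee_fin; exact: sqnormC2D.
rewrite esumD; last 2 first.
- by move=> x _; rewrite lee_fin mulr_ge0// sqnormC2_ge0.
- by move=> x _; rewrite lee_fin mulr_ge0// sqnormC2_ge0.
by apply: leeD; apply: esumZ => // x; exact: sqnormC2_ge0.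
Qed.

Lemma ell2_sqnormZle (a : R[i]) psi :
  (ell2_sqnorm (a *: psi)%R <= (Normc.normc a ^+ 2)%:E * ell2_sqnorm psi)%E.
Proof.
have := @esumZ _ (fun x => sqnormC2 (psi x)) (sqr_ge0 (Normc.normc a)).
move=> /(_ (fun x => sqnormC2_ge0 _)); apply: le_trans.
apply: le_esum => x _; rewrite -sqnormC2Z; exact: lexx.
Qed.

Lemma ell2P psi : reflect (ell2_sqnorm psi < +oo)%E (psi \in ell2).
Proof. by apply: (iffP idP); rewrite inE. Qed.

Lemma ell2_submod_closed : submod_closed ell2.
Proof.
split.
  apply/ell2P; rewrite /ell2_sqnorm esum1// => x _.
  by rewrite /sqnormC2 !mxE Normc.normc0 expr0n/= addr0.
move=> a psi phi /ell2P psi2 /ell2P phi2; apply/ell2P.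
apply: (le_lt_trans (ell2_sqnormD _ _ ltr01)).
rewrite invr1; apply: lte_add_pinfty; apply: lte_mul_pinfty => //.
apply: (le_lt_trans (ell2_sqnormZle _ _)).
by apply: lte_mul_pinfty => //; rewrite lee_fin sqr_ge0.
Qed.

HB.instance Definition _ :=
  GRing.isSubmodClosed.Build R[i] (int -> 'cV[R[i]]_2) ell2 ell2_submod_closed.

End ell2.

(* l^2(Z; C^2). The entries at 0 and 1 of psi x are psi^(0)(x) and psi^(1)(x). *)
Record hilb (R : realType) := Hilb {
  hilb_fun :> int -> 'cV[R[i]]_2;
  hilb_ell2 : hilb_fun \in @ell2 R
}.

HB.instance Definition _ (R : realType) := [isSub for @hilb_fun R].
HB.instance Definition _ (R : realType) := [Choice of hilb R by <:].
HB.instance Definition _ (R : realType) :=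
  [SubChoice_isSubLmodule of hilb R by <:].

Section hilb_norm.
Context {R : realType}.
Implicit Types psi phi : hilb R.

Definition hilb_normr psi : R := Num.sqrt (fine (ell2_sqnorm psi)).

(* A normedModType over R[i] has its norm valued in R[i]. *)
Definition hilb_norm psi : R[i] := (hilb_normr psi)%:C.

Lemma ell2_sqnorm_fin psi : ell2_sqnorm psi \is a fin_num.
Proof. by rewrite ge0_fin_numE ?ell2_sqnorm_ge0//; exact/ell2P/hilb_ell2. Qed.

Lemma fine_ell2_sqnorm_ge0 psi : 0 <= fine (ell2_sqnorm psi).
Proof. by rewrite fine_ge0// ell2_sqnorm_ge0. Qed.

Lemma hilb_normr_ge0 psi : 0 <= hilb_normr psi.
Proof. exact: sqrtr_ge0. Qed.

Lemma sqr_hilb_normr psi : hilb_normr psi ^+ 2 = fine (ell2_sqnorm psi).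
Proof. by rewrite sqr_sqrtr// fine_ell2_sqnorm_ge0. Qed.

Lemma hilb_normr_eq0 psi : hilb_normr psi = 0 -> psi = 0.
Proof.
move=> n0; have := sqr_hilb_normr psi; rewrite n0 expr0n/= => s0.
apply/val_inj/funext => x /=; apply: sqnormC2_eq0.
apply/eqP; rewrite eq_le sqnormC2_ge0 andbT -lee_fin.
have e0 : ell2_sqnorm psi = 0%:E by rewrite -(fineK (ell2_sqnorm_fin psi)) -s0.
rewrite -e0; apply: esum_ge; exists [set x]; last by rewrite fsbig_set1.
by split=> //; exact: finite_set1.
Qed.

Lemma hilb_normrD psi phi :
  hilb_normr (psi + phi) <= hilb_normr psi + hilb_normr phi.
Proof.
have [/hilb_normr_eq0->|a0] := eqVneq (hilb_normr psi) 0.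
  by rewrite add0r lerDr hilb_normr_ge0.
have [/hilb_normr_eq0->|b0] := eqVneq (hilb_normr phi) 0.
  by rewrite addr0 lerDl hilb_normr_ge0.
have {}a0 : 0 < hilb_normr psi by rewrite lt_def a0 hilb_normr_ge0.
have {}b0 : 0 < hilb_normr phi by rewrite lt_def b0 hilb_normr_ge0.
rewrite -ler_sqr ?nnegrE ?addr_ge0 ?hilb_normr_ge0//.
have t0 : 0 < hilb_normr phi / hilb_normr psi by rewrite divr_gt0.
have := ell2_sqnormD psi phi t0.
rewrite -(fineK (ell2_sqnorm_fin psi)) -(fineK (ell2_sqnorm_fin phi)).
rewrite -[X in (X <= _)%E](fineK (ell2_sqnorm_fin (psi + phi))) -!EFinM -EFinD lee_fin.
rewrite -!sqr_hilb_normr => /le_trans; apply.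
rewrite le_eqVlt; apply/orP; left; apply/eqP; field.
by rewrite !gt_eqF.
Qed.

Lemma hilb_normrZle (a : R[i]) psi :
  hilb_normr (a *: psi) <= Normc.normc a * hilb_normr psi.
Proof.
rewrite -ler_sqr ?nnegrE ?mulr_ge0 ?hilb_normr_ge0 ?normc_ge0//.
rewrite exprMn !sqr_hilb_normr -lee_fin EFinM !fineK ?ell2_sqnorm_fin//.
exact: ell2_sqnormZle.
Qed.

Lemma hilb_normrZ (a : R[i]) psi :
  hilb_normr (a *: psi) = Normc.normc a * hilb_normr psi.
Proof.
apply/eqP; rewrite eq_le hilb_normrZle/=.
have [->|a0] := eqVneq a 0; first by rewrite Normc.normc0 mul0r hilb_normr_ge0.
have na0 : 0 < Normc.normc a.
  by rewrite lt_def normc_ge0 andbT; apply: contra_neq a0; exact: Normc.eq0_normc.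
rewrite -ler_pdivlMl// -Normc.normcV.
by apply: le_trans (hilb_normrZle _ _); rewrite scalerA mulVf// scale1r.
Qed.

Lemma ler_hilb_normD psi phi :
  hilb_norm (psi + phi) <= hilb_norm psi + hilb_norm phi.
Proof. by rewrite /hilb_norm -rmorphD/= lecR hilb_normrD. Qed.

Lemma hilb_normZ (a : R[i]) psi :
  hilb_norm (a *: psi) = `|a| * hilb_norm psi.
Proof.
by rewrite /hilb_norm hilb_normrZ rmorphM/=; congr (_ * _); case: a.
Qed.

Lemma hilb_norm_eq0 psi : hilb_norm psi = 0 -> psi = 0.
Proof. by move=> /complexI/hilb_normr_eq0. Qed.

End hilb_norm.

HB.instance Definition _ (R : realType) :=
  Lmodule_isNormed.Build R[i] (hilb R)
    (@ler_hilb_normD R) (@hilb_normZ R) (@hilb_norm_eq0 R).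

Record unitary2 (R : realType) := Unitary2 {
  unitary2_mx :> 'M[R[i]]_2;
  unitary2P : unitary2_mx \is unitarymx
}.

Section operators.
Context {R : realType}.
Implicit Types psi phi : hilb R.

Lemma sqnormC2E (v : 'cV[R[i]]_2) :
  (sqnormC2 v)%:C%:M = (map_mx Num.conj v)^T *m v :> 'M[R[i]]_1.
Proof.
apply/matrixP => i j; rewrite !ord1 !mxE big_ord_recl big_ord1 !mxE /=.
rewrite -!normCKC /sqnormC2 rmorphD !rmorphXn/=.
have E (z : R[i]) : `|z| = (Normc.normc z)%:C by case: z.
have -> : lift ord0 ord0 = 1 :> 'I_2 by exact: val_inj.
by rewrite !E mulr1n.
Qed.

Lemma sqnormC2_unitary (A : unitary2 R) (v : 'cV[R[i]]_2) :
  sqnormC2 (A *m v) = sqnormC2 v.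
Proof.
have AA : (map_mx Num.conj A)^T *m A = 1%:M.
  have := unitary2P A; move/unitarymxP/mulmx1C; by rewrite map_trmx.
suff /matrixP/(_ 0 0) : (sqnormC2 (A *m v))%:C%:M = (sqnormC2 v)%:C%:M :> 'M[R[i]]_1.
  by rewrite !mxE !mulr1n => /complexI.
rewrite !sqnormC2E map_mxM trmx_mul -!mulmxA.
by rewrite (mulmxA _ (unitary2_mx A)) AA mul1mx.
Qed.

Definition shift_fun (f : int -> 'cV[R[i]]_2) : int -> 'cV[R[i]]_2 :=
  fun x => \col_j (if j == 0 then f (x + 1) 0 0 else f (x - 1) 1 0).

Definition restr_fun (A : set int) (f : int -> 'cV[R[i]]_2) :
  int -> 'cV[R[i]]_2 := fun x => if x \in A then f x else 0.

Definition coin_fun (C : int -> unitary2 R) (f : int -> 'cV[R[i]]_2) :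
  int -> 'cV[R[i]]_2 := fun x => C x *m f x.

Lemma esum_translate (f : int -> \bar R) (a : int) :
  (\esum_(x in [set: int]) f (x + a)%R = \esum_(x in [set: int]) f x)%E.
Proof.
rewrite [RHS](reindex_esum [set: int] [set: int] (fun x => x + a))//.
split=> // [x y _ _ /addIr//|y _]; exists (y - a) => //=; exact: subrK.
Qed.

Lemma shift_ell2 psi : shift_fun psi \in ell2.
Proof.
apply/ell2P; rewrite /ell2_sqnorm.
have n0 (z : R[i]) : (0 <= (Normc.normc z ^+ 2)%:E)%E by rewrite lee_fin sqr_ge0.
rewrite (_ : (\esum_(x in _) _)%E = ell2_sqnorm psi); first exact/ell2P/hilb_ell2.
transitivity (\esum_(x in [set: int]) ((Normc.normc (psi (x + 1)%R 0%R 0%R) ^+ 2)%:E +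
   (Normc.normc (psi (x - 1)%R 1%R 0%R) ^+ 2)%:E))%E.
  by apply: eq_esum => x _; rewrite /sqnormC2 !mxE EFinD.
rewrite esumD//.
rewrite (esum_translate (fun x => (Normc.normc (psi x 0 0) ^+ 2)%:E)).
rewrite (esum_translate (fun x => (Normc.normc (psi x 1 0) ^+ 2)%:E)).
by rewrite -esumD.
Qed.

Lemma restr_ell2 (A : set int) psi : restr_fun A psi \in ell2.
Proof.
apply/ell2P; apply: le_lt_trans (ell2P _ (hilb_ell2 psi)).
apply: le_esum => x _; rewrite lee_fin /restr_fun.
case: ifPn => // _.
by rewrite {1}/sqnormC2 !mxE Normc.normc0 expr0n/= addr0 sqnormC2_ge0.
Qed.

Lemma coin_ell2 (C : int -> unitary2 R) psi : coin_fun C psi \in ell2.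
Proof.
apply/ell2P; apply: le_lt_trans (ell2P _ (hilb_ell2 psi)).
by apply: le_esum => x _; rewrite lee_fin sqnormC2_unitary.
Qed.

Definition shift_op psi : hilb R := Hilb (shift_ell2 psi).

Definition restr_op (A : set int) psi : hilb R := Hilb (restr_ell2 A psi).

Definition coin_op (C : int -> unitary2 R) psi : hilb R := Hilb (coin_ell2 C psi).

Lemma shift_op_linear : linear shift_op.
Proof.
move=> a psi phi; apply/val_inj/funext => x; apply/matrixP => i j.
by rewrite /= /shift_fun !mxE; case: ifP.
Qed.

Lemma restr_op_linear A : linear (restr_op A).
Proof.
move=> a psi phi; apply/val_inj/funext => x.
rewrite /= /restr_fun; case: ifPn => xA.
  by rewrite -[RHS]/(a *: restr_fun A psi x + restr_fun A phi x) /restr_fun xA.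
rewrite -[RHS]/(a *: restr_fun A psi x + restr_fun A phi x) /restr_fun.
by rewrite (negbTE xA) scaler0 addr0.
Qed.

Lemma coin_op_linear C : linear (coin_op C).
Proof.
move=> a psi phi; apply/val_inj/funext => x.
rewrite -[RHS]/(a *: coin_fun C psi x + coin_fun C phi x) /= /coin_fun.
by rewrite scalemxAr -mulmxDr.
Qed.

HB.instance Definition _ :=
  GRing.isLinear.Build R[i] (hilb R) (hilb R) *:%R shift_op shift_op_linear.
HB.instance Definition _ A :=
  GRing.isLinear.Build R[i] (hilb R) (hilb R) *:%R (restr_op A)
    (restr_op_linear A).
HB.instance Definition _ C :=
  GRing.isLinear.Build R[i] (hilb R) (hilb R) *:%R (coin_op C)
    (coin_op_linear C).

(* F_e C_1 + (1 - F_e) C_2 *)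
Definition defect_coin (e : set int) (C1 : unitary2 R) (C2 : int -> unitary2 R) :
    {linear hilb R -> hilb R} :=
  (restr_op e \o coin_op (fun=> C1)) \+
  ((idfun \- restr_op e) \o coin_op C2).

Definition walk (C : {linear hilb R -> hilb R}) : {linear hilb R -> hilb R} :=
  shift_op \o C.

End operators.

Section model.
Context {R : realType}.
Implicit Types t p q alpha beta gamma : R.

Definition expi t : R[i] := cos t +i* sin t.

Definition mx2 (a b c d : R[i]) : 'M[R[i]]_2 :=
  \matrix_(i, j) if i == 0 then (if j == 0 then a else b)
                 else (if j == 0 then c else d).

Definition C0 p q alpha beta gamma : 'M[R[i]]_2 :=
  mx2 (p%:C * expi alpha) (q%:C * expi beta)
      (- (q%:C * expi (- (beta - gamma)))) (p%:C * expi (- (alpha - gamma))).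

Definition C1_mx beta gamma : 'M[R[i]]_2 :=
  expi (gamma / 2) *:
    mx2 0 (expi (beta - gamma / 2)) (- expi (- (beta - gamma / 2))) 0.

Lemma expi_conj t : expi t * (expi t)^* = 1.
Proof.
apply/eqP; rewrite eq_complex /expi/=.
by rewrite mulrN opprK -!expr2 cos2Dsin2 eqxx mulrC mulNr addrC subrr eqxx.
Qed.

Lemma C1_unitary beta gamma : C1_mx beta gamma \is unitarymx.
Proof.
have E t : expi t * Num.conj (expi t) = 1 := expi_conj t.
apply/unitarymxP; rewrite /C1_mx; apply/matrixP => i j.
rewrite !mxE big_ord_recl big_ord1 !mxE/=.
case: i => -[|[|//]] ?; case: j => -[|[|//]] ? /=;
  rewrite ?mulr0 ?mul0r ?rmorph0 ?mulr0 ?add0r ?addr0 ?rmorphM ?rmorphN/= //.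
- by rewrite mulrACA !E mulr1.
- by rewrite mulrACA mulrNN !E mulr1.
Qed.

Definition C1 beta gamma : unitary2 R := Unitary2 (C1_unitary beta gamma).

Definition bracket (x : int) : R := Num.sqrt (1 + x%:~R ^+ 2).

Definition edges (N : nat) (y : 'I_N -> int) : set int :=
  \bigcup_(j in [set: 'I_N]) [set y j - 1; y j].

(* A set of real numbers: not taken modulo 2 pi. *)
Definition J p gamma : set R :=
  `[acos p + gamma / 2, pi - acos p + gamma / 2]%classic `|`
  `[pi + acos p + gamma / 2, 2 * pi - acos p + gamma / 2]%classic.

Definition J_T p gamma : set R :=
  [set acos p + gamma / 2; pi - acos p + gamma / 2;
       pi + acos p + gamma / 2; 2 * pi - acos p + gamma / 2].

Definition thresholds p gamma (U : {linear hilb R -> hilb R}) : set R[i] :=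
  [set expi theta | theta in J_T p gamma] `&` ess_spectrum U.

End model.

(* Main.v *)
(* Put kappa = Re (lambda e^(-i gamma / 2)): the spectrum of the constant walk
   S C0 is |kappa| <= p on the unit circle, with thresholds |kappa| = p.

   With a defect at {y - 1, y}, the off-diagonal coin C1 traps the span of the
   component 0 at y - 1 and the component 1 at y, which gives the eigenvalue
   e^(i (gamma' + pi) / 2). It lies inside the bands |kappa| < p, and truncated plane waves
   located far to the right show that the bands consist of spectrum, so this
   eigenvalue is not isolated.

   Without defect, let lambda be an eigenvalue, so |lambda| = 1.
   - If |kappa| < p, an eigenfunction satisfies psi (x + 1) = T_x psi x where
     T_x tends exponentially fast to an elliptic matrix. The latter preserves a
     positive definite form, so psi does not decay.
   - If |kappa| > p, then S C0 - lambda is bounded below, and U differs from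
     S C0 by a small operator outside a finite box. On the box, |a_2| >= delta
     lets the transfer matrices recover psi from psi 0. Hence
     |psi| <= K (|psi 0| + |(U - lambda) psi|), so the eigenspace has dimension
     at most two. Mean ergodic averages of the isometry U show that approximate
     eigenvectors of distinct spectral points are almost independent, so at most
     two points of the spectrum lie near lambda, which is therefore isolated.
   Since U is unitary, U - mu is invertible as soon as it is bounded below. *)

Require Import Defs.
From HB Require Import structures.
From mathcomp Require Import all_boot all_order all_algebra.
From mathcomp Require Import finmap complex.
From mathcomp Require Import all_classical all_reals all_analysis.
From mathcomp Require Import ring lra zify.

Set Implicit Arguments.
Unset Strict Implicit.
Unset Printing Implicit Defensive.

Import Order.TTheory GRing.Theory Num.Theory.
Import numFieldNormedType.Exports.

Local Open Scope classical_set_scope.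
Local Open Scope ring_scope.
Local Open Scope complex_scope.

(** * Real-valued modulus on the complex numbers and on [C^2] *)

Section complex_modulus.
Context {R : realType}.
Implicit Types (z w : R[i]) (v u : 'cV[R[i]]_2).

(** Takes values in [R], where the order is total, unlike the norm of [R[i]]. *)
Definition cabs z : R := Normc.normc z.

Lemma cabsE z : `|z| = (cabs z)%:C.
Proof. by case: z. Qed.

Lemma cabs_ge0 z : 0 <= cabs z.
Proof. exact: normc_ge0. Qed.

Lemma cabs0 : cabs 0 = 0.
Proof. exact: Normc.normc0. Qed.

Lemma cabs1 : cabs 1 = 1.
Proof. exact: Normc.normc1. Qed.

Lemma cabsM z w : cabs (z * w) = cabs z * cabs w.
Proof. exact: Normc.normcM. Qed.

Lemma cabsV z : cabs z^-1 = (cabs z)^-1.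
Proof. exact: Normc.normcV. Qed.

Lemma cabsX z k : cabs (z ^+ k) = cabs z ^+ k.
Proof. by elim: k => [|k IH]; rewrite ?cabs1// !exprS cabsM IH. Qed.

Lemma cabsN z : cabs (- z) = cabs z.
Proof. exact: normcN. Qed.

Lemma cabsB z w : cabs (z - w) = cabs (w - z).
Proof. by rewrite -cabsN opprB. Qed.

Lemma le_cabsD z w : cabs (z + w) <= cabs z + cabs w.
Proof. exact: le_normcD. Qed.

Lemma cabs_eq0 z : (cabs z == 0) = (z == 0).
Proof. by apply/eqP/eqP => [/Normc.eq0_normc//|->]; exact: cabs0. Qed.

Lemma cabs_gt0 z : (0 < cabs z) = (z != 0).
Proof. by rewrite lt_def cabs_ge0 andbT cabs_eq0. Qed.

Lemma sqr_cabs z : cabs z ^+ 2 = complex.Re z ^+ 2 + complex.Im z ^+ 2.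
Proof. by case: z => a b; rewrite /cabs /= sqr_sqrtr// addr_ge0 ?sqr_ge0. Qed.

Lemma cabs_real (r : R) : cabs r%:C = `|r|.
Proof. by rewrite /cabs /= expr0n addr0 sqrtr_sqr. Qed.

Lemma cabs_expi (t : R) : cabs (expi t) = 1.
Proof. by rewrite /cabs /= cos2Dsin2 sqrtr1. Qed.

Lemma expiD (s t : R) : expi (s + t) = expi s * expi t.
Proof.
apply/eqP; rewrite eq_complex /= cosD sinD eqxx /=; apply/eqP; ring.
Qed.

Lemma expi0 : expi 0 = 1 :> R[i].
Proof. by rewrite /expi cos0 sin0. Qed.

Lemma expi_neq0 (t : R) : expi t != 0.
Proof. by rewrite -cabs_eq0 cabs_expi oner_eq0. Qed.

Lemma expiN (t : R) : expi (- t) = (expi t)^-1.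
Proof.
by apply: (mulfI (expi_neq0 t)); rewrite -expiD subrr expi0 divff ?expi_neq0.
Qed.

Lemma cabs_eq1_neq0 z : cabs z = 1 -> z != 0.
Proof. by move=> z1; rewrite -cabs_eq0 z1 oner_eq0. Qed.

Lemma mulmx2E (A : 'M[R[i]]_2) v i :
  (A *m v) i 0 = A i 0 * v 0 0 + A i 1 * v 1 0.
Proof.
rewrite mxE big_ord_recl big_ord1; congr (_ + A i _ * v _ 0); exact: val_inj.
Qed.

Lemma cV2P v u : v 0 0 = u 0 0 -> v 1 0 = u 1 0 -> v = u.
Proof.
move=> e0 e1; apply/matrixP => i j; rewrite (ord1 j).
have /orP[/eqP->|/eqP->] // : (i == 0) || (i == 1) by case: i => -[|[|]].
Qed.

Lemma sqnormC20 : sqnormC2 (0 : 'cV[R[i]]_2) = 0.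
Proof. by rewrite /sqnormC2 !mxE Normc.normc0 expr0n addr0. Qed.

Lemma sqnormC2_cabs v : sqnormC2 v = cabs (v 0 0) ^+ 2 + cabs (v 1 0) ^+ 2.
Proof. by []. Qed.

Lemma sqnormC2_gt0 v : v != 0 -> 0 < sqnormC2 v.
Proof.
move=> v0; rewrite lt_def sqnormC2_ge0 andbT.
by apply: contra_neq v0; exact: sqnormC2_eq0.
Qed.

(** Each row contributes at most [(e (x + y))^2], with [x] and [y] the moduli of the entries of [v],
    and [(x + y)^2 <= 2 (x^2 + y^2)]; the two rows give the factor 4. *)
Lemma sqnormC2_mul (A : 'M[R[i]]_2) v (e : R) :
  (forall i j, cabs (A i j) <= e) ->
  sqnormC2 (A *m v) <= 4 * e ^+ 2 * sqnormC2 v.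
Proof.
move=> Ae; rewrite !sqnormC2_cabs !mulmx2E.
set x := cabs (v 0 0); set y := cabs (v 1 0).
have x0 : 0 <= x by exact: cabs_ge0.
have y0 : 0 <= y by exact: cabs_ge0.
have e0 : 0 <= e by apply: le_trans (cabs_ge0 _) (Ae 0 0).
have key i : cabs (A i 0 * v 0 0 + A i 1 * v 1 0) ^+ 2 <= (e * (x + y)) ^+ 2.
  rewrite ler_sqr ?nnegrE ?cabs_ge0 ?mulr_ge0 ?addr_ge0//.
  apply: le_trans (le_cabsD _ _) _; rewrite !cabsM mulrDr.
  by rewrite lerD// ler_wpM2r.
apply: le_trans (lerD (key 0) (key 1)) _.
rewrite -subr_ge0.
have -> : 4 * e ^+ 2 * (x ^+ 2 + y ^+ 2) - ((e * (x + y)) ^+ 2 + (e * (x + y)) ^+ 2)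
  = 2 * (e * (x - y)) ^+ 2 by ring.
by rewrite mulr_ge0 ?sqr_ge0.
Qed.

End complex_modulus.

Arguments cabs {R} z : simpl never.

(** * The norm of [l^2] through finite sums, and some isometries *)

Section hilbert_norm.
Context {R : realType}.
Implicit Types (psi phi : hilb R) (c : R).

Local Notation n := (@hilb_normr R).

Lemma hilbDE psi phi x : (psi + phi) x = psi x + phi x. Proof. by []. Qed.
Lemma hilbNE psi x : (- psi) x = - psi x. Proof. by []. Qed.
Lemma hilbZE (a : R[i]) psi x : (a *: psi) x = a *: psi x. Proof. by []. Qed.

Lemma hilb_addE psi phi x i j : (psi + phi) x i j = psi x i j + phi x i j.
Proof. by rewrite hilbDE mxE. Qed.

Lemma hilb_oppE psi x i j : (- psi) x i j = - psi x i j.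
Proof. by rewrite hilbNE mxE. Qed.

Lemma hilb_scaleE (a : R[i]) psi x i j : (a *: psi) x i j = a * psi x i j.
Proof. by rewrite hilbZE mxE. Qed.

Lemma hilbP psi phi : (forall x, psi x = phi x) -> psi = phi.
Proof. by move=> e; apply/val_inj/funext. Qed.

Lemma hilb_normE psi : `|psi| = (n psi)%:C.
Proof. by []. Qed.

Lemma hilb_normr0 : n 0 = 0.
Proof. by apply: complexI; rewrite -hilb_normE normr0. Qed.

Lemma hilb_normrN psi : n (- psi) = n psi.
Proof. by apply: complexI; rewrite -!hilb_normE normrN. Qed.

Lemma hilb_normrB psi phi : n (psi - phi) <= n psi + n phi.
Proof. by rewrite -(hilb_normrN phi) hilb_normrD. Qed.

Lemma hilb_normr_subC psi phi : n (psi - phi) = n (phi - psi).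
Proof. by rewrite -hilb_normrN opprB. Qed.

Lemma ler_hilb_dist psi phi : n psi - n phi <= n (psi - phi).
Proof. by rewrite lerBlDr; have := hilb_normrD (psi - phi) phi; rewrite subrK. Qed.

Lemma hilb_normr_gt0 psi : psi != 0 -> 0 < n psi.
Proof.
move=> psi0; rewrite lt_def hilb_normr_ge0 andbT.
by apply: contra_neq psi0; exact: hilb_normr_eq0.
Qed.

Lemma hilb_normr_sum (I : Type) (s : seq I) (F : I -> hilb R) :
  n (\sum_(i <- s) F i) <= \sum_(i <- s) n (F i).
Proof.
elim: s => [|i s IH]; first by rewrite !big_nil hilb_normr0.
by rewrite !big_cons; apply: le_trans (hilb_normrD _ _) _; rewrite lerD2l.
Qed.

(** The extended sum is a supremum over finite sets, so norm estimates reduce to uniform bounds on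
    finite sums. *)
Lemma ell2_sqnorm_le (f : int -> 'cV[R[i]]_2) c :
  (forall s : seq int, uniq s -> \sum_(x <- s) sqnormC2 (f x) <= c) ->
  (ell2_sqnorm f <= c%:E)%E.
Proof.
move=> h; apply: ge_ereal_sup => _ [A [finA _]] <-.
by rewrite fsbig_finite//= sumEFin lee_fin; exact/h/fset_uniq.
Qed.

Lemma ell2_le (f : int -> 'cV[R[i]]_2) c :
  (forall s : seq int, uniq s -> \sum_(x <- s) sqnormC2 (f x) <= c) ->
  f \in ell2.
Proof. by move=> h; apply/ell2P; apply: le_lt_trans (ell2_sqnorm_le h) (ltry _). Qed.

Lemma sqr_hilb_normr_le psi c :
  (forall s : seq int, uniq s -> \sum_(x <- s) sqnormC2 (psi x) <= c) ->
  n psi ^+ 2 <= c.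
Proof.
move=> /ell2_sqnorm_le h.
by rewrite sqr_hilb_normr -lee_fin fineK ?ell2_sqnorm_fin.
Qed.

Lemma sum_sqnormC2_le psi (s : seq int) : uniq s ->
  \sum_(x <- s) sqnormC2 (psi x) <= n psi ^+ 2.
Proof.
move=> us; rewrite sqr_hilb_normr -lee_fin fineK ?ell2_sqnorm_fin// -sumEFin.
rewrite fsbig_seq//; apply: esum_ge; exists [set` s] => //.
by split => //; exact: finite_seq.
Qed.

Lemma sqnormC2_le_norm psi x : sqnormC2 (psi x) <= n psi ^+ 2.
Proof. by have := @sum_sqnormC2_le psi [:: x] isT; rewrite big_seq1. Qed.

Lemma cabs_le_norm psi x i : cabs (psi x i 0) <= n psi.
Proof.
rewrite -ler_sqr ?nnegrE ?cabs_ge0 ?hilb_normr_ge0//.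
apply: le_trans (sqnormC2_le_norm psi x); rewrite sqnormC2_cabs.
have /orP[/eqP->|/eqP->] : (i == 0) || (i == 1) by case: i => -[|[|]].
- by rewrite lerDl sqr_ge0.
- by rewrite lerDr sqr_ge0.
Qed.

Lemma hilb_normr_coin (A : int -> unitary2 R) psi : n (coin_op A psi) = n psi.
Proof.
rewrite /hilb_normr; congr (Num.sqrt (fine _)).
by apply: eq_esum => x _; rewrite /= sqnormC2_unitary.
Qed.

Lemma hilb_normr_shift psi : n (shift_op psi) = n psi.
Proof.
rewrite /hilb_normr; congr (Num.sqrt (fine _)).
have n0 (z : R[i]) : (0 <= (Normc.normc z ^+ 2)%:E)%E by rewrite lee_fin sqr_ge0.
transitivity (\esum_(x in [set: int]) ((Normc.normc (psi (x + 1)%R 0%R 0%R) ^+ 2)%:E +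
   (Normc.normc (psi (x - 1)%R 1%R 0%R) ^+ 2)%:E))%E.
  by apply: eq_esum => x _; rewrite /sqnormC2 !mxE EFinD.
rewrite esumD//.
rewrite (esum_translate (fun x => (Normc.normc (psi x 0 0) ^+ 2)%:E)).
rewrite (esum_translate (fun x => (Normc.normc (psi x 1 0) ^+ 2)%:E)).
by rewrite -esumD.
Qed.

Definition trans_fun (a : int) (f : int -> 'cV[R[i]]_2) := fun x => f (x + a).

Lemma ell2_sqnorm_trans a (f : int -> 'cV[R[i]]_2) :
  ell2_sqnorm (trans_fun a f) = ell2_sqnorm f.
Proof. exact: (esum_translate (fun x => (sqnormC2 (f x))%:E)). Qed.

Lemma trans_ell2 a psi : trans_fun a psi \in ell2.
Proof. by apply/ell2P; rewrite ell2_sqnorm_trans; exact/ell2P/hilb_ell2. Qed.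

Definition trans_op a psi : hilb R := Hilb (trans_ell2 a psi).

Lemma trans_opE a psi x : trans_op a psi x = psi (x + a).
Proof. by []. Qed.

Lemma hilb_normr_trans a psi : n (trans_op a psi) = n psi.
Proof. by rewrite /hilb_normr ell2_sqnorm_trans. Qed.

End hilbert_norm.

(** * Completeness of [l^2] and fixed points of contractions *)

Section completeness.
Context {R : realType}.
Local Notation n := (@hilb_normr R).

Lemma geometric_small (r A e : R) : 0 <= r < 1 -> 0 < e ->
  exists k, forall i, (k <= i)%N -> A * r ^+ i <= e.
Proof.
move=> /andP[r0 r1] e0.
have r1' : `|r| < 1 by rewrite ger0_norm.
have /cvgrPdist_le/(_ e e0)[k _ hk] : A * r ^+ i @[i --> \oo] --> 0.
  by rewrite -[X in _ --> X](mulr0 A); apply: cvgMr; exact: cvg_expr.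
exists k => i /hk /=; rewrite sub0r normrN; exact/le_trans/ler_norm.
Qed.

(** [l] is the supremum of the lower bounds [a i - K * r ^+ i], each of which lies below every upper
    bound [a j + K * r ^+ j]. *)
Lemma geometric_cauchy_limit (a : nat -> R) (K r : R) : 0 <= r <= 1 ->
  (forall j k, `|a (j + k)%N - a j| <= K * r ^+ j) ->
  exists l, forall j, `|a j - l| <= K * r ^+ j.
Proof.
move=> /andP[r0 r1] h.
have cross i j : a i - K * r ^+ i <= a j + K * r ^+ j.
  have K0 : 0 <= K.
    by have := le_trans (normr_ge0 _) (h 0%N 0%N); rewrite expr0 mulr1.
  have p k : 0 <= K * r ^+ k by rewrite mulr_ge0 ?exprn_ge0.
  case: (leqP i j) => ij.
    have := h i (j - i)%N; rewrite subnKC// ler_norml => /andP[+ _].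
    by have := p j; lra.
  have := h j (i - j)%N; rewrite subnKC 1?ltnW// ler_norml => /andP[_].
  by have := p i; lra.
pose S := range (fun i => a i - K * r ^+ i).
have S0 : S !=set0 by exists (a 0%N - K * r ^+ 0); exists 0%N.
have ubS j : ubound S (a j + K * r ^+ j) by move=> _ [i _ <-]; exact: cross.
exists (sup S) => j; rewrite ler_norml; apply/andP; split.
  by rewrite lerNl opprB lerBlDl; apply: ge_sup.
rewrite lerBlDr -lerBlDl; apply: ub_le_sup; first by exists (a 0%N + K * r ^+ 0).
by exists j.
Qed.

Lemma geometric_dist (u : nat -> hilb R) (K r : R) : 0 <= r < 1 ->
  (forall j, n (u j.+1 - u j) <= K * r ^+ j) ->
  forall j k, n (u (j + k)%N - u j) <= K / (1 - r) * r ^+ j.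
Proof.
move=> /andP[r0 r1] h j k.
have d0 : 0 < 1 - r by rewrite subr_gt0.
have K0 : 0 <= K.
  by have := le_trans (hilb_normr_ge0 _) (h 0%N); rewrite expr0 mulr1.
(* Carrying the exact partial geometric sum, through the factor [1 - r ^+ k], makes the induction on
   [k] close. *)
suff : n (u (j + k)%N - u j) <= K / (1 - r) * r ^+ j * (1 - r ^+ k).
  move/le_trans; apply; rewrite ler_piMr ?mulr_ge0 ?exprn_ge0 ?invr_ge0//.
    exact: ltW.
  by rewrite gerBl exprn_ge0.
elim: k => [|k IH].
  by rewrite addn0 subrr hilb_normr0 expr0 subrr mulr0.
have -> : u (j + k.+1)%N - u j =
    (u (j + k).+1 - u (j + k)%N) + (u (j + k)%N - u j).
  by rewrite addnS addrA subrK.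
apply: le_trans (hilb_normrD _ _) _; apply: le_trans (lerD (h _) IH) _.
rewrite le_eqVlt; apply/orP; left; apply/eqP.
by rewrite exprD exprS; field; rewrite gt_eqF.
Qed.

(** Completeness in quantitative form: limits are taken entry by entry, and bounds on finite sums,
    uniform in the finite set, place the limit in [ell2] and control the distance to it. *)
Lemma hilb_geometric_cvg (u : nat -> hilb R) (K r : R) : 0 <= r < 1 ->
  (forall j, n (u j.+1 - u j) <= K * r ^+ j) ->
  exists K' psi, forall j, n (u j - psi) <= K' * r ^+ j.
Proof.
move=> r01 h; have /andP[r0 r1] := r01.
have hd := geometric_dist r01 h; set L := K / (1 - r) in hd.
have r1' : 0 <= r <= 1 by rewrite r0 ltW.
have L0 : 0 <= L.
  by have := le_trans (hilb_normr_ge0 _) (hd 0%N 0%N); rewrite expr0 mulr1.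
clearbody L.
have lim (x : int) (i : 'I_2) : exists l : R[i],
    forall j, cabs (u j x i 0 - l) ^+ 2 <= 2 * (L * r ^+ j) ^+ 2.
  have hx j k : cabs (u (j + k)%N x i 0 - u j x i 0) <= L * r ^+ j.
    apply: le_trans (hd j k); have := cabs_le_norm (u (j + k)%N - u j) x i.
    by rewrite hilbDE hilbNE !mxE.
  have part (f : R[i] -> R) : (forall z w, f (z - w) = f z - f w) ->
      (forall z, f z ^+ 2 <= cabs z ^+ 2) ->
      exists l, forall j, `|f (u j x i 0) - l| <= L * r ^+ j.
    move=> fB fle; apply: geometric_cauchy_limit => // j k; rewrite -fB.
    apply: le_trans (hx j k); rewrite -ler_sqr ?nnegrE ?cabs_ge0//.
    by rewrite real_normK ?num_real.
  have [||l1 h1] := part (@complex.Re R); first by move=> [? ?] [? ?].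
    by move=> z; rewrite sqr_cabs lerDl sqr_ge0.
  have [||l2 h2] := part (@complex.Im R); first by move=> [? ?] [? ?].
    by move=> z; rewrite sqr_cabs lerDr sqr_ge0.
  exists (l1 +i* l2) => j; rewrite sqr_cabs.
  move: (h1 j) (h2 j); case: (u j x i 0) => a b /= ha hb.
  have Lr : 0 <= L * r ^+ j by rewrite mulr_ge0 ?exprn_ge0.
  have -> : 2 * (L * r ^+ j) ^+ 2 = (L * r ^+ j) ^+ 2 + (L * r ^+ j) ^+ 2 by ring.
  by apply: lerD; rewrite -[leLHS](real_normK (num_real _)) ler_sqr ?nnegrE.
pose g x i := projT1 (cid (lim x i)).
have hg x i j : cabs (u j x i 0 - g x i) ^+ 2 <= 2 * (L * r ^+ j) ^+ 2.
  exact: (projT2 (cid (lim x i))).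
pose f x : 'cV[R[i]]_2 := \col_i g x i.
have key j (s : seq int) : uniq s ->
    \sum_(x <- s) sqnormC2 (u j x - f x) <= (2 * (L * r ^+ j)) ^+ 2.
  move=> us; apply/ler_addgt0Pr => e e0.
  (* For fixed [s], [u j] is compared with a later [u i]: their distance is controlled in norm,
     while the entrywise error of [u i], summed over the finite [s], drops below [e] once [i] is
     large. *)
  pose A : R := (size s)%:R * 8 * L ^+ 2.
  have r2 : 0 <= r ^+ 2 < 1 by rewrite exprn_ge0//= expr_lt1.
  have [k hk] := geometric_small A r2 e0.
  pose i := maxn k j.
  have le1 x : sqnormC2 (u j x - f x) <=
      2 * sqnormC2 ((u i - u j) x) + 8 * (L * r ^+ i) ^+ 2.
    have -> : u j x - f x = - (u i - u j) x + (u i x - f x).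
      by rewrite hilbDE hilbNE opprB addrA subrK.
    apply: le_trans (sqnormC2D _ _ ltr01) _; rewrite invr1.
    have -> : sqnormC2 (- (u i - u j) x) = sqnormC2 ((u i - u j) x).
      by rewrite !sqnormC2_cabs !mxE !cabsN.
    rewrite lerD2l (_ : 8 = (1 + 1) * 4 :> R); last by ring.
    rewrite -mulrA ler_wpM2l// sqnormC2_cabs !mxE.
    apply: le_trans (lerD (hg _ _ _) (hg _ _ _)) _.
    by rewrite -mulrDl -natrD.
  apply: le_trans (ler_sum _ (fun x _ => le1 x)) _; rewrite big_split /=.
  apply: lerD.
    rewrite -mulr_sumr exprMn.
    apply: (@le_trans _ _ (2 * (L * r ^+ j) ^+ 2)).
      rewrite ler_wpM2l//; apply: le_trans (sum_sqnormC2_le (u i - u j) us) _.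
      rewrite ler_sqr ?nnegrE ?hilb_normr_ge0 ?mulr_ge0 ?exprn_ge0//.
      by have := hd j (i - j)%N; rewrite subnKC ?leq_maxr.
    by rewrite ler_wpM2r ?sqr_ge0//; lra.
  rewrite big_const_seq count_predT iter_addr_0.
  apply: le_trans (hk i (leq_maxl _ _)).
  rewrite /A exprMn -mulr_natl exprAC.
  by rewrite le_eqVlt; apply/orP; left; apply/eqP; ring.
have f2 : f \in ell2.
  have -> : f = val (u 0%N) - (val (u 0%N) - f) by rewrite opprB addrC subrK.
  apply: rpredB; first exact: (hilb_ell2 (u 0%N)).
  by apply: (@ell2_le _ _ ((2 * (L * r ^+ 0)) ^+ 2)) => s us; exact: key.
exists (2 * L), (Hilb f2) => j.
rewrite -ler_sqr ?nnegrE ?hilb_normr_ge0 ?mulr_ge0 ?exprn_ge0//.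
by apply: sqr_hilb_normr_le => s us; rewrite -mulrA; exact: key.
Qed.

(** Banach's principle: the iterates from 0 have geometric increments, and their limit is fixed
    because [F] is Lipschitz. *)
Lemma hilb_fixpoint (F : hilb R -> hilb R) (r : R) : 0 <= r < 1 ->
  (forall a b, n (F a - F b) <= r * n (a - b)) -> exists psi, F psi = psi.
Proof.
move=> r01 h; have /andP[r0 r1] := r01.
pose u j := iter j F 0.
have hu j : n (u j.+1 - u j) <= n (F 0) * r ^+ j.
  elim: j => [|j IH]; first by rewrite /u /= subr0 expr0 mulr1.
  apply: le_trans (h _ _) _; rewrite exprS mulrCA.
  by rewrite ler_wpM2l.
have [K [psi hpsi]] := hilb_geometric_cvg r01 hu.
exists psi; apply/eqP; rewrite -subr_eq0; apply/eqP/hilb_normr_eq0/le_anti.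
rewrite hilb_normr_ge0 andbT; apply/ler_addgt0Pr => e e0; rewrite add0r.
have [k hk] := geometric_small (2 * K * r) r01 e0.
apply: le_trans (hk k (leqnn _)).
have -> : F psi - psi = (F psi - F (u k)) + (u k.+1 - psi).
  by rewrite addrA subrK.
apply: le_trans (hilb_normrD _ _) _.
apply: (@le_trans _ _ (r * (K * r ^+ k) + K * r ^+ k.+1)).
  apply: lerD => //; apply: le_trans (h _ _) _.
  by rewrite ler_wpM2l// hilb_normr_subC.
by rewrite exprS le_eqVlt; apply/orP; left; apply/eqP; ring.
Qed.

End completeness.

(** * Lower bounds, the resolvent set and the spectrum of a unitary operator *)

Section resolvent.
Context {R : realType}.
Local Notation n := (@hilb_normr R).
Variable U : {linear hilb R -> hilb R}.
Implicit Types (psi f : hilb R) (mu : R[i]) (c : R).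

Definition bounded_below mu c : Prop :=
  forall psi, c * n psi <= n (U psi - mu *: psi).

Definition sub_scalar_surj mu : Prop := forall f, exists psi, U psi - mu *: psi = f.

Lemma sub_scalarB mu psi f :
  U (psi - f) - mu *: (psi - f) = (U psi - mu *: psi) - (U f - mu *: f).
Proof.
rewrite linearB scalerBr !opprB addrACA [RHS]addrACA; congr (_ + _).
exact: addrC.
Qed.

Lemma bounded_below_perturb mu mu' c : bounded_below mu c ->
  bounded_below mu' (c - cabs (mu' - mu)).
Proof.
move=> h psi; rewrite mulrBl -hilb_normrZ lerBlDr.
apply: le_trans (h psi) _; apply: le_trans (hilb_normrD _ _).
by rewrite scalerBl addrA subrK.
Qed.

(** With [H] the inverse of [U - mu], Lipschitz of constant [c^-1], a solution for [mu'] is a fixed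
    point of [psi |-> H (f + (mu' - mu) psi)], a contraction since [cabs (mu' - mu) < c]. *)
Lemma surj_perturb mu mu' c : bounded_below mu c -> sub_scalar_surj mu ->
  cabs (mu' - mu) < c -> sub_scalar_surj mu'.
Proof.
move=> hb hs mc f.
have c0 : 0 < c by apply: le_lt_trans mc; exact: cabs_ge0.
pose H g := projT1 (cid (hs g)).
have HK g : U (H g) - mu *: H g = g by exact: (projT2 (cid (hs g))).
have HB g1 g2 : n (H g1 - H g2) <= c^-1 * n (g1 - g2).
  rewrite -ler_pdivrMl ?invr_gt0// invrK; apply: le_trans (hb _) _.
  by rewrite sub_scalarB !HK.
have [||psi hpsi] := @hilb_fixpoint _
    (fun psi => H (f + (mu' - mu) *: psi)) (c^-1 * cabs (mu' - mu)).
- by rewrite mulr_ge0 ?cabs_ge0 ?invr_ge0 ?(ltW c0)//= ltr_pdivrMl// mulr1.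
- move=> a b; apply: le_trans (HB _ _) _.
  rewrite -mulrA ler_wpM2l ?invr_ge0 ?(ltW c0)//.
  by rewrite opprD addrACA subrr add0r -scalerBr hilb_normrZ.
exists psi; have := HK (f + (mu' - mu) *: psi); rewrite hpsi => e.
apply/eqP; rewrite -(subr_eq0 _ f) -(inj_eq (addIr f)) subrK add0r; apply/eqP.
by move: e => /(congr1 (fun z => z - (mu' - mu) *: psi)); rewrite addrK scalerBl opprB addrA subrK.
Qed.

Lemma resolvent_bounded_below mu : in_resolvent U mu ->
  exists2 c, 0 < c & bounded_below mu c.
Proof.
move=> [G [Gc GK _]].
have /linear_boundedP/pinfty_ex_gt0[K K0 hK] := (iffRL (linear_bounded_continuous G) Gc).
(* Positivity in [R[i]] includes being real, so the operator bound [K] comes from [R]. *)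
have [k Kk] : exists k : R, K = k%:C.
  by exists (complex.Re K); move: K0; case: K {hK} => a b; rewrite ltcE /= => /andP[/eqP-> _].
have k0 : 0 < k by move: K0; rewrite Kk ltcR.
exists k^-1; first by rewrite invr_gt0.
move=> psi; rewrite ler_pdivrMl//.
by have := hK (U psi - mu *: psi); rewrite GK !hilb_normE Kk -rmorphM lecR.
Qed.

(** The lower bound gives injectivity, which makes the chosen right inverse [G] linear and
    two-sided, and it bounds [G] by [c^-1]. *)
Lemma bounded_below_resolvent mu c : 0 < c -> bounded_below mu c ->
  sub_scalar_surj mu -> in_resolvent U mu.
Proof.
move=> c0 hb hs.
pose G g := projT1 (cid (hs g)).
have GK g : U (G g) - mu *: G g = g by exact: (projT2 (cid (hs g))).
have inj a b : U a - mu *: a = U b - mu *: b -> a = b.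
  move=> e; apply/eqP; rewrite -subr_eq0; apply/eqP/hilb_normr_eq0/le_anti.
  rewrite hilb_normr_ge0 andbT -(ler_pM2l c0) mulr0.
  by apply: le_trans (hb _) _; rewrite sub_scalarB e subrr hilb_normr0.
have Glin : linear G.
  move=> a f g; apply: inj; rewrite GK linearP scalerDr scalerA mulrC -scalerA.
  by rewrite opprD addrACA -scalerBr !GK.
pose HG := GRing.isLinear.Build _ _ _ _ _ Glin.
pose GL : {linear hilb R -> hilb R} := HB.pack G HG.
exists GL; split; last exact: GK.
- apply/linear_bounded_continuous/linear_boundedP.
  have hG x : n (G x) <= c^-1 * n x.
    by rewrite -ler_pdivrMl ?invr_gt0// invrK; apply: le_trans (hb _) _; rewrite GK.
  near=> r => x; rewrite hilb_normE.
  apply: (@le_trans _ _ ((c^-1)%:C * `|x|)).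
    by rewrite hilb_normE -rmorphM lecR hG.
  rewrite ler_wpM2r//; near: r; apply: nbhs_pinfty_ge.
  by rewrite complex_real.
- by move=> v; apply: inj; rewrite GK.
Unshelve. all: by end_near. Qed.

Hypothesis U_isometry : forall psi, n (U psi) = n psi.
Hypothesis U_surj : forall f, exists psi, U psi = f.

Lemma bounded_below_lt1 mu : bounded_below mu (1 - cabs mu).
Proof.
move=> psi; rewrite mulrBl mul1r -hilb_normrZ -{1}U_isometry.
exact: ler_hilb_dist.
Qed.

Lemma bounded_below_gt1 mu : bounded_below mu (cabs mu - 1).
Proof.
move=> psi; rewrite mulrBl mul1r -hilb_normrZ -[X in _ - X]U_isometry.
by rewrite hilb_normr_subC; exact: ler_hilb_dist.
Qed.

(** Perturbation from 0, where [U] itself is onto and bounded below by 1. *)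
Lemma sub_scalar_surj_lt1 mu : cabs mu < 1 -> sub_scalar_surj mu.
Proof.
move=> mu1; apply: (@surj_perturb 0 mu 1); last by rewrite subr0.
  by move=> psi; rewrite mul1r scale0r subr0 U_isometry.
by move=> f; have [psi e] := U_surj f; exists psi; rewrite scale0r subr0.
Qed.

(** The equation reads [psi = mu^-1 (U psi - f)], a contraction of ratio [(cabs mu)^-1]. *)
Lemma sub_scalar_surj_gt1 mu : 1 < cabs mu -> sub_scalar_surj mu.
Proof.
move=> mu1 f.
have m0 : 0 < cabs mu by apply: lt_trans mu1.
have mu0 : mu != 0 by rewrite -cabs_gt0.
have [||psi hpsi] := @hilb_fixpoint _
  (fun psi => mu^-1 *: (U psi - f)) (cabs mu)^-1.
- by rewrite invr_ge0 ltW//= invf_lt1.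
- move=> a b; rewrite -scalerBr hilb_normrZ -/(cabs _) cabsV.
  by rewrite opprB addrA subrK -linearB U_isometry.
exists psi; rewrite -{2}hpsi scalerA divff// scale1r opprB addrC subrK //.
Qed.

(* Approximate [mu] on the unit circle by [(1 - s) mu], for which the
   resolvent is known to exist. *)
Lemma unitary_resolvent mu c : 0 < c -> bounded_below mu c -> in_resolvent U mu.
Proof.
move=> c0 hb; apply: (bounded_below_resolvent c0 hb).
case: (ltgtP (cabs mu) 1) => mu1.
- exact: sub_scalar_surj_lt1.
- exact: sub_scalar_surj_gt1.
(* With [s <= c / 3], [nu] keeps the lower bound [c - s], which exceeds the distance [s] back to
   [mu]; [s <= 1 / 2] keeps [1 - s] nonnegative. *)
pose s := Num.min (1/2) (c / 3).
have s0 : 0 < s by rewrite lt_min !divr_gt0.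
have s1 : s <= 1 / 2 by rewrite ge_min lexx.
have s2 : s <= c / 3 by rewrite ge_min lexx orbT.
pose nu := (1 - s)%:C * mu.
have d : nu - mu = - (s%:C * mu) by rewrite /nu rmorphB /= mulrBl mul1r addrAC subrr add0r.
have cd : cabs (nu - mu) = s by rewrite d cabsN cabsM mu1 mulr1 cabs_real gtr0_norm.
apply: (@surj_perturb nu mu (c - s)).
- by rewrite -cd; apply: bounded_below_perturb.
- apply: sub_scalar_surj_lt1; rewrite cabsM mu1 mulr1 cabs_real ger0_norm; lra.
- by rewrite cabsB cd; lra.
Qed.

(** Weyl's criterion: membership in the spectrum becomes the failure of every lower bound, that is,
    the existence of approximate eigenvectors. *)
Lemma spectrumP mu :
  spectrum U mu <-> forall c, 0 < c -> ~ bounded_below mu c.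
Proof.
split; first by move=> h c c0 /(unitary_resolvent c0).
by move=> h /resolvent_bounded_below[c c0]; exact: h.
Qed.

Lemma eigenvalue_spectrum mu : is_eigenvalue U mu -> spectrum U mu.
Proof.
move=> [psi psi0 e]; apply/spectrumP => c c0 /(_ psi).
rewrite e subrr hilb_normr0 leNgt mulr_gt0//; exact: hilb_normr_gt0.
Qed.

Lemma spectrum_unit mu : spectrum U mu -> cabs mu = 1.
Proof.
move=> /spectrumP h; case: (ltgtP (cabs mu) 1) => // mu1.
- by case: (h (1 - cabs mu)); [rewrite subr_gt0|exact: bounded_below_lt1].
- by case: (h (cabs mu - 1)); [rewrite subr_gt0|exact: bounded_below_gt1].
Qed.

Lemma spectrum_approx_eigenvector mu e : 0 < e -> spectrum U mu ->
  exists2 psi, n psi = 1 & n (U psi - mu *: psi) <= e.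
Proof.
move=> e0 /spectrumP/(_ e e0) h; apply: contrapT => no; apply: h => psi.
have [->|psi0] := eqVneq psi 0; first by rewrite hilb_normr0 mulr0 hilb_normr_ge0.
have np := hilb_normr_gt0 psi0.
rewrite leNgt; apply/negP => lt; apply: no.
have ca : cabs (n psi)^-1%:C = (n psi)^-1.
  by rewrite cabs_real ger0_norm// invr_ge0 ltW.
exists ((n psi)^-1%:C *: psi).
  by rewrite hilb_normrZ -/(cabs _) ca mulVf// gt_eqF.
rewrite linearZ /= scalerA mulrC -scalerA -scalerBr hilb_normrZ -/(cabs _) ca.
by rewrite ler_pdivrMl// mulrC ltW.
Qed.

End resolvent.

(** * Finite supports and bounds up to a finite set *)

Section finite_support.
Context {R : realType}.

Lemma sum_indicator_le (s t : seq int) (b : R) : uniq s -> 0 <= b ->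
  \sum_(x <- s) (if x \in t then b else 0) <= b *+ size t.
Proof.
move=> us b0; rewrite -big_mkcond /= big_const_seq iter_addr_0.
rewrite ler_wpMn2l// -size_filter uniq_leq_size ?filter_uniq//.
by move=> x; rewrite mem_filter => /andP[].
Qed.

Lemma finite_support_ell2 (f : int -> 'cV[R[i]]_2) (t : seq int) (b : R) :
  0 <= b -> (forall x, sqnormC2 (f x) <= if x \in t then b else 0) ->
  f \in ell2.
Proof.
move=> b0 h; apply: (@ell2_le _ _ (b *+ size t)) => s us.
exact: le_trans (ler_sum _ (fun x _ => h x)) (sum_indicator_le _ us b0).
Qed.

(** Serves to compare walks whose coins are close off the finite set [t], and to bound residuals of
    truncated waves. *)
Lemma sqr_hilb_normr_le_fin (psi phi : hilb R) (a b : R) (t : seq int) :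
  0 <= a -> 0 <= b ->
  (forall x, sqnormC2 (phi x) <=
     a * sqnormC2 (psi x) + (if x \in t then b else 0)) ->
  hilb_normr phi ^+ 2 <= a * hilb_normr psi ^+ 2 + b *+ size t.
Proof.
move=> a0 b0 h; apply: sqr_hilb_normr_le => s us.
apply: le_trans (ler_sum _ (fun x _ => h x)) _; rewrite big_split /=.
apply: lerD; last exact: sum_indicator_le.
by rewrite -mulr_sumr ler_wpM2l// sum_sqnormC2_le.
Qed.

End finite_support.

(** * Entries of unitary matrices of size 2 *)

Section unitary_entries.
Context {R : realType}.
Implicit Types V : unitary2 R.

Lemma unitary2_row V i : cabs (V i 0) ^+ 2 + cabs (V i 1) ^+ 2 = 1.
Proof.
have /unitarymxP/matrixP/(_ i i) := unitary2P V.
rewrite !mxE big_ord_recl big_ord1 !mxE eqxx mulr1n.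
have -> : lift ord0 ord0 = 1 :> 'I_2 by exact: val_inj.
by rewrite -!normCK !cabsE -!rmorphXn -rmorphD /= => /complexI.
Qed.

Lemma unitary2_trmxC V : ((unitary2_mx V) ^t Num.conj)%sesqui \is unitarymx.
Proof. by rewrite trmxC_unitary unitary2P. Qed.

Definition adj2 V : unitary2 R := Unitary2 (unitary2_trmxC V).

Lemma adj2K V : V *m adj2 V = 1%:M.
Proof. exact/unitarymxP/unitary2P. Qed.

Lemma unitary2_col V j : cabs (V 0 j) ^+ 2 + cabs (V 1 j) ^+ 2 = 1.
Proof.
have := unitary2_row (adj2 V) j; rewrite !mxE.
have E (z : R[i]) : cabs (Num.conj z) = cabs z.
  by apply: complexI; rewrite -!cabsE norm_conjC.
by rewrite !E.
Qed.

Lemma unitary2_le1 V i j : cabs (V i j) <= 1.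
Proof.
rewrite -(@ler_sqr _ _ 1) ?nnegrE ?cabs_ge0// expr1n -(unitary2_row V i).
have /orP[/eqP->|/eqP->] : (j == 0) || (j == 1) by case: j => -[|[|]].
- by rewrite lerDl sqr_ge0.
- by rewrite lerDr sqr_ge0.
Qed.

(** Row 0 and column 1 both have norm 1 and share the entry [V 0 1]. *)
Lemma unitary2_diag V : cabs (V 1 1) = cabs (V 0 0).
Proof.
apply/eqP; rewrite -(eqrXn2 (n := 2))// ?cabs_ge0//; apply/eqP.
have := unitary2_row V 0; have := unitary2_col V 1; lra.
Qed.

Lemma swap_unitary : mx2 0 1 1 0 \is @unitarymx R[i] 2 2.
Proof.
apply/unitarymxP/matrixP => i j; rewrite !mxE big_ord_recl big_ord1 !mxE/=.
by case: i => -[|[|//]] ?; case: j => -[|[|//]] ? /=;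
  rewrite ?mulr0 ?mul0r ?rmorph0 ?rmorph1 ?mulr0 ?mulr1 ?add0r ?addr0.
Qed.

Definition swap2 : unitary2 R := Unitary2 swap_unitary.

End unitary_entries.

(** * Walks with position-dependent coins: trapped states and transfer estimates *)

Section walk_basics.
Context {R : realType}.
Local Notation n := (@hilb_normr R).
Variables (A : int -> unitary2 R) (U : {linear hilb R -> hilb R}).
Hypothesis UE : forall psi, U psi = shift_op (coin_op A psi).

Lemma walk_E0 psi x : U psi x 0 0 =
  A (x + 1) 0 0 * psi (x + 1) 0 0 + A (x + 1) 0 1 * psi (x + 1) 1 0.
Proof. by rewrite UE /= mxE /= mulmx2E. Qed.

Lemma walk_E1 psi x : U psi x 1 0 =
  A (x - 1) 1 0 * psi (x - 1) 0 0 + A (x - 1) 1 1 * psi (x - 1) 1 0.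
Proof. by rewrite UE /= mxE /= mulmx2E. Qed.

Lemma walk_isometry psi : n (U psi) = n psi.
Proof. by rewrite UE hilb_normr_shift hilb_normr_coin. Qed.

(* The inverse of the shift is its conjugate by the swap of the two
   components. *)
Lemma walk_surj f : exists psi, U psi = f.
Proof.
pose P := coin_op (fun=> @swap2 R).
exists (coin_op (fun x => adj2 (A x)) (P (shift_op (P f)))).
have E (v : 'cV[R[i]]_2) : ((swap2 *m v) 0 0 = v 1 0) * ((swap2 *m v) 1 0 = v 0 0).
  by split; rewrite mulmx2E !mxE /= mul1r mul0r ?addr0 ?add0r.
rewrite UE; apply: hilbP => x; apply: cV2P;
  rewrite /= mxE /= /coin_fun mulmxA adj2K mul1mx E /shift_fun mxE /= E.
- by rewrite addrK.
- by rewrite subrK.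
Qed.

(** The two vanishing entries close the span of component 0 at [y - 1] and component 1 at [y] under
    [U], which acts there as an antidiagonal matrix with square [A y 0 1 * A (y - 1) 1 0]. *)
Lemma localized_eigenvalue (y : int) (lambda : R[i]) :
  A (y - 1) 0 0 = 0 -> A y 1 1 = 0 ->
  lambda != 0 -> lambda ^+ 2 = A y 0 1 * A (y - 1) 1 0 ->
  is_eigenvalue U lambda.
Proof.
move=> a0 d0 l0 l2.
(* With component 1 at [y] normalized to 1, the equation for component 0 at [y - 1] forces [u]. *)
pose u := A y 0 1 / lambda.
pose f x : 'cV[R[i]]_2 :=
  \col_i (if i == 0 then (if x == y - 1 then u else 0) else (x == y)%:R).
have f2 : f \in ell2.
  apply: (@finite_support_ell2 _ _ [:: y - 1; y] (cabs u ^+ 2 + 1)).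
    by rewrite addr_ge0 ?sqr_ge0.
  move=> x; rewrite sqnormC2_cabs !mxE /= !inE.
  by case: (x == y - 1); case: (x == y); rewrite /= ?mulr1n ?mulr0n ?cabs1 ?cabs0
    ?expr1n ?expr0n /= ?addr0 ?add0r ?lexx ?lerDl ?lerDr ?ler01 ?sqr_ge0.
exists (Hilb f2).
  apply/eqP => /(congr1 (fun psi : hilb R => psi y 1 0)) /=.
  by rewrite !mxE /= eqxx => /eqP; rewrite oner_eq0.
apply: hilbP => x; apply: cV2P; rewrite ?walk_E0 ?walk_E1 hilbZE !mxE /=.
- have -> : (x + 1 == y) = (x == y - 1) by lia.
  have [e|_] := eqVneq (x + 1) (y - 1).
    have -> : (x == y - 1) = false by lia.
    by rewrite e a0 mul0r !mulr0 addr0.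
  rewrite mulr0 add0r; have [->|_] := eqVneq x (y - 1); last by rewrite !mulr0.
  by rewrite subrK mulr1 mulrC divfK.
- have -> : (x - 1 == y - 1) = (x == y) by lia.
  have [->|_] := eqVneq x y.
    have -> : (y - 1 == y) = false by lia.
    by rewrite mulr0 addr0 mulr1 mulrA [_ * A y 0 1]mulrC -l2 expr2 mulfK.
  rewrite mulr0 add0r; have [->|_] := eqVneq (x - 1) y; last by rewrite !mulr0.
  by rewrite d0 mul0r mulr0.
Qed.

Variable lambda : R[i].
Hypothesis lambda1 : cabs lambda = 1.
Variable delta : R.
Hypothesis delta0 : 0 < delta.
Hypothesis A_ge : forall x, delta <= cabs (A x 0 0).

Definition abs2 (v : 'cV[R[i]]_2) : R := cabs (v 0 0) + cabs (v 1 0).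

Lemma abs2_ge0 v : 0 <= abs2 v.
Proof. by rewrite addr_ge0 ?cabs_ge0. Qed.

Lemma sqnormC2_le_abs2 v : sqnormC2 v <= abs2 v ^+ 2.
Proof.
rewrite sqnormC2_cabs -subr_ge0 [X in 0 <= X](_ : _ = 2 * (cabs (v 0 0) * cabs (v 1 0))).
  by rewrite !mulr_ge0 ?cabs_ge0.
by rewrite /abs2; ring.
Qed.

Lemma defect_E0 (psi : hilb R) (x : int) : (U psi - lambda *: psi) x 0 0 =
  U psi x 0 0 - lambda * psi x 0 0.
Proof. by rewrite hilbDE hilbNE hilbZE !mxE. Qed.

Lemma defect_E1 (psi : hilb R) (x : int) : (U psi - lambda *: psi) x 1 0 =
  U psi x 1 0 - lambda * psi x 1 0.
Proof. by rewrite hilbDE hilbNE hilbZE !mxE. Qed.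

(** Loss in one transfer step: one new component is bounded directly, the other after division by a
    coin entry of modulus at least [delta]. *)
Let K := 1 + 2 / delta.

Let arith (s a p q : R) : 0 <= a -> 0 <= q -> q <= s + a ->
  delta * p <= s + a + q -> p + q <= K * (s + a).
Proof.
move=> a0 q0 q1 h.
have : p <= (2 * (s + a)) / delta by rewrite ler_pdivlMr// mulrC; lra.
have -> : K * (s + a) = s + a + 2 * (s + a) / delta by rewrite /K; ring.
lra.
Qed.

(** The equation at [x + 1] gives component 1, with unimodular factor [lambda]; the equation at [x]
    then gives component 0 after division by [A (x + 1) 0 0]. *)
Lemma transfer_right (psi : hilb R) (x : int) :
  abs2 (psi (x + 1)) <= K * (abs2 (psi x) + n (U psi - lambda *: psi)).
Proof.
set f := U psi - lambda *: psi.
have e1 : f (x + 1) 1 0 = A x 1 0 * psi x 0 0 + A x 1 1 * psi x 1 0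
    - lambda * psi (x + 1) 1 0.
  by rewrite /f defect_E1 walk_E1 addrK.
have e0 : f x 0 0 = A (x + 1) 0 0 * psi (x + 1) 0 0 +
    A (x + 1) 0 1 * psi (x + 1) 1 0 - lambda * psi x 0 0.
  by rewrite /f defect_E0 walk_E0.
have g1 : cabs (psi (x + 1) 1 0) <= abs2 (psi x) + n f.
  have -> : cabs (psi (x + 1) 1 0) = cabs (lambda * psi (x + 1) 1 0).
    by rewrite cabsM lambda1 mul1r.
  have -> : lambda * psi (x + 1) 1 0 =
      A x 1 0 * psi x 0 0 + A x 1 1 * psi x 1 0 - f (x + 1) 1 0.
    by rewrite e1; ring.
  apply: le_trans (le_cabsD _ _) _; rewrite cabsN lerD ?cabs_le_norm//.
  apply: le_trans (le_cabsD _ _) _; rewrite !cabsM.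
  by rewrite lerD// ler_piMl ?cabs_ge0 ?unitary2_le1.
apply: arith; rewrite ?hilb_normr_ge0 ?cabs_ge0//.
apply: (@le_trans _ _ (cabs (A (x + 1) 0 0 * psi (x + 1) 0 0))).
  by rewrite cabsM ler_wpM2r ?cabs_ge0.
have -> : A (x + 1) 0 0 * psi (x + 1) 0 0 =
    lambda * psi x 0 0 + f x 0 0 - A (x + 1) 0 1 * psi (x + 1) 1 0.
  by rewrite e0; ring.
apply: le_trans (le_cabsD _ _) _; rewrite cabsN lerD//.
  apply: le_trans (le_cabsD _ _) _; rewrite lerD ?cabs_le_norm//.
  by rewrite cabsM lambda1 mul1r lerDl cabs_ge0.
by rewrite cabsM ler_piMl ?cabs_ge0 ?unitary2_le1.
Qed.

(** Mirror image: component 0 comes first, and the division is by [A (x - 1) 1 1], which has the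
    modulus of [A (x - 1) 0 0] by unitarity. *)
Lemma transfer_left (psi : hilb R) (x : int) :
  abs2 (psi (x - 1)) <= K * (abs2 (psi x) + n (U psi - lambda *: psi)).
Proof.
set f := U psi - lambda *: psi.
have e0 : f (x - 1) 0 0 = A x 0 0 * psi x 0 0 + A x 0 1 * psi x 1 0
    - lambda * psi (x - 1) 0 0.
  by rewrite /f defect_E0 walk_E0 subrK.
have e1 : f x 1 0 = A (x - 1) 1 0 * psi (x - 1) 0 0 +
    A (x - 1) 1 1 * psi (x - 1) 1 0 - lambda * psi x 1 0.
  by rewrite /f defect_E1 walk_E1.
have g1 : cabs (psi (x - 1) 0 0) <= abs2 (psi x) + n f.
  have -> : cabs (psi (x - 1) 0 0) = cabs (lambda * psi (x - 1) 0 0).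
    by rewrite cabsM lambda1 mul1r.
  have -> : lambda * psi (x - 1) 0 0 =
      A x 0 0 * psi x 0 0 + A x 0 1 * psi x 1 0 - f (x - 1) 0 0.
    by rewrite e0; ring.
  apply: le_trans (le_cabsD _ _) _; rewrite cabsN lerD ?cabs_le_norm//.
  apply: le_trans (le_cabsD _ _) _; rewrite !cabsM.
  by rewrite lerD// ler_piMl ?cabs_ge0 ?unitary2_le1.
rewrite /abs2 [leLHS]addrC; apply: arith; rewrite ?hilb_normr_ge0 ?cabs_ge0//.
apply: (@le_trans _ _ (cabs (A (x - 1) 1 1 * psi (x - 1) 1 0))).
  by rewrite cabsM unitary2_diag ler_wpM2r ?cabs_ge0.
have -> : A (x - 1) 1 1 * psi (x - 1) 1 0 =
    lambda * psi x 1 0 + f x 1 0 - A (x - 1) 1 0 * psi (x - 1) 0 0.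
  by rewrite e1; ring.
apply: le_trans (le_cabsD _ _) _; rewrite cabsN lerD//.
  apply: le_trans (le_cabsD _ _) _; rewrite lerD ?cabs_le_norm//.
  by rewrite cabsM lambda1 mul1r lerDr cabs_ge0.
by rewrite cabsM ler_piMl ?cabs_ge0 ?unitary2_le1.
Qed.

Lemma transfer_point (x0 x : int) : exists2 L, 0 <= L & forall psi : hilb R,
  abs2 (psi x) <= L * (abs2 (psi x0) + n (U psi - lambda *: psi)).
Proof.
have K0 : 0 <= K by rewrite addr_ge0// divr_ge0// ltW.
have step (w z : int) : (exists2 L, 0 <= L & forall psi : hilb R,
      abs2 (psi w) <= L * (abs2 (psi x0) + n (U psi - lambda *: psi))) ->
    (forall psi : hilb R, abs2 (psi z) <= K * (abs2 (psi w) + n (U psi - lambda *: psi))) ->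
    exists2 L, 0 <= L & forall psi : hilb R,
      abs2 (psi z) <= L * (abs2 (psi x0) + n (U psi - lambda *: psi)).
  move=> [L L0 hL] h; exists (K * (L + 1)).
    by rewrite mulr_ge0// addr_ge0.
  move=> psi; apply: le_trans (h psi) _; rewrite -mulrA ler_wpM2l//.
  rewrite mulrDl mul1r lerD// lerDr; exact: abs2_ge0.
suff h (d : int) : exists2 L, 0 <= L & forall psi : hilb R,
    abs2 (psi (x0 + d)) <= L * (abs2 (psi x0) + n (U psi - lambda *: psi)).
  by have := h (x - x0); rewrite addrC subrK.
elim: d => [|d IH|d IH].
- by exists 1 => // psi; rewrite addr0 mul1r lerDl hilb_normr_ge0.
- apply: step IH _ => psi; rewrite intS (addrC 1) addrA; exact: transfer_right.
- apply: step IH _ => psi; rewrite intS opprD (addrC (- 1)) addrA.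
  exact: transfer_left.
Qed.

Lemma transfer_box (x0 : int) (t : seq int) : exists2 L, 0 <= L &
  forall (psi : hilb R) (x : int), x \in t ->
    abs2 (psi x) <= L * (abs2 (psi x0) + n (U psi - lambda *: psi)).
Proof.
elim: t => [|z t [L L0 hL]]; first by exists 0.
have [M M0 hM] := transfer_point x0 z.
exists (L + M); first by rewrite addr_ge0.
move=> psi x; rewrite inE mulrDl.
have p0 : 0 <= abs2 (psi x0) + n (U psi - lambda *: psi).
  by rewrite addr_ge0 ?abs2_ge0 ?hilb_normr_ge0.
case/orP => [/eqP->|xt].
  by apply: le_trans (hM psi) _; rewrite lerDr mulr_ge0.
by apply: le_trans (hL psi x xt) _; rewrite lerDl mulr_ge0.
Qed.

Lemma eigenvector_eq0 (psi : hilb R) (x0 : int) :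
  U psi = lambda *: psi -> psi x0 = 0 -> psi = 0.
Proof.
move=> e e0; apply: hilbP => x; have [L L0 /(_ psi)] := transfer_point x0 x.
rewrite e subrr hilb_normr0 e0 addr0 /abs2 !mxE cabs0 addr0 mulr0 => h.
apply/sqnormC2_eq0/le_anti; rewrite sqnormC2_ge0 andbT.
apply: le_trans (sqnormC2_le_abs2 _) _.
have -> : abs2 (psi x) = 0 by apply/le_anti; rewrite abs2_ge0 h.
by rewrite expr0n.
Qed.

End walk_basics.

(** * Isolated points in metric terms *)

Section isolated_points.
Context {K : numFieldType}.
Implicit Types (A : set K) (x y e : K).

Lemma isolatedP A x : isolated A x <->
  A x /\ exists2 e, 0 < e & forall y, A y -> `|y - x| < e -> y = x.
Proof.
split=> [[]|[Ax [e e0 h]]].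
  rewrite inE => Ax [V /nbhs_ballP[e /= e0 eV] VA]; split => //.
  exists e => // y Ay yx; have : (V `&` A) y.
    by split=> //; apply: eV; rewrite -ball_normE /ball_ /= distrC.
  by rewrite VA.
split; first by rewrite inE.
exists (ball x e); first exact: nbhsx_ballx.
apply/seteqP; split => [y [+ Ay]|_ ->]; last by split => //; exact: ballxx.
by rewrite -ball_normE /ball_ /= distrC => /(h y Ay).
Qed.

End isolated_points.

(** * Linear dependence in [C^2] *)

Section linear_dependence.
Context {R : realType}.

(** The matrix with the three rows [v i] has rank at most 2, so its left kernel contains a nonzero
    row. *)
Lemma dependent3 (v : 'I_3 -> 'cV[R[i]]_2) :
  exists2 c : 'I_3 -> R[i], exists i, c i != 0 & \sum_i c i *: v i = 0.
Proof.
pose M : 'M[R[i]]_(3, 2) := \matrix_(i, j) v i j 0.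
have ker0 : kermx M != 0.
  by rewrite kermx_eq0 /row_free neq_ltn (leq_ltn_trans (rank_leq_col M)).
pose r := nz_row (kermx M).
have r0 : r != 0 by rewrite nz_row_eq0.
have rM : r *m M = 0 by apply: sub_kermxP; exact: nz_row_sub.
exists (fun i => r 0 i).
  apply: contrapT => h; case/negP: r0; apply/eqP/matrixP => i j.
  rewrite (ord1 i) mxE; apply: contrapT => rj; apply: h; exists j.
  by apply/eqP.
apply/matrixP => j k; rewrite (ord1 k) summxE mxE.
move/matrixP: rM => /(_ 0 j); rewrite !mxE => h; rewrite -[RHS]h.
by apply: eq_bigr => i _; rewrite !mxE.
Qed.

End linear_dependence.

(** * Ergodic averages of an isometry and its approximate eigenvectors *)

Section almost_independence.
Context {R : realType}.
Local Notation n := (@hilb_normr R).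
Variable U : {linear hilb R -> hilb R}.
Hypothesis U_isometry : forall psi, n (U psi) = n psi.

Lemma iter_isometry l psi : n (iter l U psi) = n psi.
Proof. by elim: l => //= l IH; rewrite U_isometry. Qed.

Lemma iter_linear_sum (m l : nat) (c : 'I_m -> R[i]) (psi : 'I_m -> hilb R) :
  iter l U (\sum_j c j *: psi j) = \sum_j c j *: iter l U (psi j).
Proof.
elim: l => //= l ->; rewrite linear_sum; apply: eq_bigr => j _.
by rewrite linearZ.
Qed.

(** By isometry, each application of [U] adds at most one [eta] to the error. *)
Lemma iter_approx_eigenvector (mu : R[i]) (eta : R) psi l : cabs mu = 1 ->
  n (U psi - mu *: psi) <= eta ->
  n (iter l U psi - mu ^+ l *: psi) <= l%:R * eta.
Proof.
move=> mu1 h; elim: l => [|l IH]; first by rewrite expr0 scale1r subrr hilb_normr0 mul0r.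
have -> : iter l.+1 U psi - mu ^+ l.+1 *: psi =
    U (iter l U psi - mu ^+ l *: psi) + mu ^+ l *: (U psi - mu *: psi).
  by rewrite linearB [U (_ *: _)]linearZ /= scalerBr scalerA -exprSr addrA subrK.
apply: le_trans (hilb_normrD _ _) _.
rewrite U_isometry hilb_normrZ -/(cabs _) cabsX mu1 expr1n mul1r.
by rewrite -natr1 mulrDl mul1r lerD.
Qed.

Lemma geometric_sum_bound (z : R[i]) k : cabs z = 1 -> z != 1 ->
  cabs (\sum_(l < k) z ^+ l) <= 2 / cabs (1 - z).
Proof.
move=> z1 zn1.
have d0 : 0 < cabs (1 - z) by rewrite cabs_gt0 subr_eq0 eq_sym.
rewrite ler_pdivlMr// -cabsM mulrC -opprB mulNr -subrX1 opprB.
apply: le_trans (le_cabsD _ _) _.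
by rewrite cabsN cabs1 cabsX z1 expr1n.
Qed.

(* The ergodic averages [k^-1 \sum_(l < k) (U / mu i) ^ l] are contractions
   almost fixing [psi i] and almost killing the other [psi j]. *)
Lemma almost_independent (m : nat) (mu : 'I_m -> R[i]) (kappa : R) :
  injective mu -> (forall i, cabs (mu i) = 1) -> 0 < kappa ->
  exists2 eta, 0 < eta & forall psi : 'I_m -> hilb R,
    (forall i, n (psi i) = 1) ->
    (forall i, n (U (psi i) - mu i *: psi i) <= eta) ->
    forall (c : 'I_m -> R[i]) i, cabs (c i) <=
      n (\sum_j c j *: psi j) + kappa * \sum_j cabs (c j).
Proof.
move=> mu_inj mu1 kappa0.
pose z i j := mu j / mu i.
have z1 i j : cabs (z i j) = 1 by rewrite cabsM cabsV !mu1 invr1 mulr1.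
(* [D] bounds every off-diagonal geometric sum uniformly in its length; the diagonal terms divide by
   zero and so equal 0. Then [k] makes [D / k] at most [kappa / 2], and [eta] makes the errors of
   the approximate eigenvectors contribute the other half. *)
pose D := \sum_i \sum_j 2 / cabs (1 - z i j).
have t0 i j : 0 <= 2 / cabs (1 - z i j) by rewrite divr_ge0 ?cabs_ge0.
have D0 : 0 <= D by do 2!apply: sumr_ge0 => ? _.
pose k := (Num.trunc (2 * D / kappa)).+1.
have k0 : 0 < k%:R :> R by rewrite ltr0n.
have kD : D <= k%:R * (kappa / 2).
  have : 2 * D / kappa <= k%:R by exact/ltW/truncnS_gt.
  by rewrite ler_pdivrMr//; lra.
exists (kappa / (2 * k%:R)); first by rewrite divr_gt0// mulr_gt0.
set eta := kappa / _ => psi npsi hpsi c i.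
set phi := \sum_j c j *: psi j; set S := \sum_j cabs (c j).
have S0 : 0 <= S by apply: sumr_ge0 => ? _; exact: cabs_ge0.
have eta0 : 0 <= eta by rewrite divr_ge0 ?mulr_ge0 ?ltW.
pose M psi := \sum_(l < k) (mu i)^-1 ^+ l *: iter l U psi.
have Mle f : n (M f) <= k%:R * n f.
  apply: le_trans (hilb_normr_sum _ _) _.
  rewrite (eq_bigr (fun=> n f)); last first.
    by move=> l _; rewrite hilb_normrZ iter_isometry -/(cabs _) cabsX cabsV mu1 invr1 expr1n mul1r.
  by rewrite sumr_const card_ord mulr_natl.
pose s j := \sum_(l < k) z i j ^+ l.
have Mj j : n (M (psi j) - s j *: psi j) <= k%:R * (k%:R * eta).
  rewrite /M /s scaler_suml -sumrB; apply: le_trans (hilb_normr_sum _ _) _.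
  rewrite (_ : k%:R * _ = \sum_(l < k) k%:R * eta); last first.
    by rewrite sumr_const card_ord mulr_natl.
  apply: ler_sum => l _; rewrite /z exprMn mulrC -scalerA -scalerBr hilb_normrZ -/(cabs _).
  rewrite cabsX cabsV mu1 invr1 expr1n mul1r.
  apply: le_trans (iter_approx_eigenvector _ (mu1 j) (hpsi j)) _.
  by rewrite ler_wpM2r// ler_nat ltnW.
have si : s i = k%:R.
  rewrite /s (eq_bigr (fun=> 1)) ?sumr_const ?card_ord// => l _.
  by rewrite /z divff ?expr1n//; exact/cabs_eq1_neq0.
have Mphi : M phi = \sum_j c j *: M (psi j).
  rewrite /M /phi; under eq_bigr do rewrite iter_linear_sum scaler_sumr.
  rewrite exchange_big /=; apply: eq_bigr => j _.
  by rewrite scaler_sumr; apply: eq_bigr => l _; rewrite !scalerA mulrC.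
(* The term [j = i] has [s i = k]; the remaining errors are those of the approximate eigenvectors
   and the bounded sums [s j]. *)
have split : (k%:R * c i) *: psi i = M phi
    - \sum_j c j *: (M (psi j) - s j *: psi j)
    - \sum_(j | j != i) (c j * s j) *: psi j.
  rewrite Mphi -sumrB; under [X in X - _]eq_bigr do rewrite -scalerBr opprB addrC subrK scalerA.
  by rewrite (bigD1 i)//= addrK si mulrC.
have : n ((k%:R * c i) *: psi i) <= k%:R * n phi + k%:R * (k%:R * eta) * S + D * S.
  rewrite split; apply: le_trans (hilb_normrB _ _) _; apply: lerD.
    apply: le_trans (hilb_normrB _ _) _; apply: lerD => //.
    apply: le_trans (hilb_normr_sum _ _) _; rewrite mulr_sumr ler_sum// => j _.
    by rewrite hilb_normrZ mulrC ler_wpM2r ?cabs_ge0.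
  rewrite -big_filter; apply: le_trans (hilb_normr_sum _ _) _.
  rewrite big_filter; apply: (@le_trans _ _ (\sum_(j | j != i) D * cabs (c j))).
    apply: ler_sum => j ji; rewrite hilb_normrZ npsi mulr1 -/(cabs _) cabsM mulrC.
    rewrite ler_wpM2r ?cabs_ge0//.
    apply: (@le_trans _ _ (2 / cabs (1 - z i j))).
      apply: geometric_sum_bound => //; rewrite /z.
      have m0 : mu i != 0 by exact: cabs_eq1_neq0.
      by rewrite -(inj_eq (mulIf m0)) divfK// mul1r (inj_eq mu_inj).
    rewrite /D (bigD1 i)//= (bigD1 j)//= -addrA lerDl addr_ge0//.
      by apply: sumr_ge0 => ? _.
    by do 2!apply: sumr_ge0 => ? _.
  rewrite -mulr_sumr ler_wpM2l// /S [leRHS](bigD1 i)//= lerDr; exact: cabs_ge0.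
have ck : cabs (k%:R : R[i]) = k%:R.
  by rewrite -(rmorph_nat (real_complex R)) cabs_real ger0_norm.
rewrite hilb_normrZ npsi mulr1 -/(cabs _) cabsM ck.
have -> : k%:R * (k%:R * eta) * S = k%:R * ((kappa / 2) * S).
  by rewrite /eta; field; rewrite gt_eqF.
move=> h; rewrite -(ler_pM2l k0); apply: le_trans h _.
have : D * S <= k%:R * (kappa / 2) * S by rewrite ler_wpM2r.
set a := k%:R; set b := n phi; lra.
Qed.

End almost_independence.

(** * Outside the bands: eigenvalues are discrete *)

Section gap.
Context {R : realType}.
Local Notation n := (@hilb_normr R).
Variables (A0 : unitary2 R) (U0 : {linear hilb R -> hilb R}).
Hypothesis U0E : forall psi, U0 psi = shift_op (coin_op (fun=> A0) psi).
Variable lambda : R[i].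
Hypothesis lambda1 : cabs lambda = 1.

(* Cayley-Hamilton for the symbol of [U0], whose trace is
   [A0 0 0 * T + A0 1 1 * T^-1] with [T] the translation. *)
Lemma constant_walk_bounded_below : bounded_below U0 lambda
  ((cabs (A0 0 0 * A0 1 1 - A0 0 1 * A0 1 0 + lambda ^+ 2)
    - cabs (A0 0 0) - cabs (A0 1 1)) / 4).
Proof.
move=> psi; set a := A0 0 0; set b := A0 0 1; set c := A0 1 0; set d := A0 1 1.
set f := U0 psi - lambda *: psi.
have key : (a * d - b * c + lambda ^+ 2) *: psi =
    lambda *: (a *: trans_op 1 psi + d *: trans_op (-1) psi)
    - (U0 f - a *: trans_op 1 f - d *: trans_op (-1) f + lambda *: f).
  have f0 (y : int) : f y 0 0 = a * psi (y + 1) 0 0 + b * psi (y + 1) 1 0 - lambda * psi y 0 0.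
    by rewrite /f defect_E0 (walk_E0 U0E).
  have f1 (y : int) : f y 1 0 = c * psi (y - 1) 0 0 + d * psi (y - 1) 1 0 - lambda * psi y 1 0.
    by rewrite /f defect_E1 (walk_E1 U0E).
  clearbody f; apply: hilbP => x; apply: cV2P;
    rewrite !(hilb_addE, hilb_oppE, hilb_scaleE) !trans_opE.
  - rewrite (walk_E0 U0E) -/a -/b !f0 f1 addrK subrK.
    move: (psi x 0 0) (psi x 1 0) (psi (x + 1) 0 0) (psi (x + 1) 1 0)
      (psi (x + 1 + 1) 0 0) (psi (x + 1 + 1) 1 0) (psi (x - 1) 0 0) => *; ring.
  - rewrite (walk_E1 U0E) -/c -/d !f1 f0 subrK addrK.
    move: (psi x 0 0) (psi x 1 0) (psi (x - 1) 0 0) (psi (x - 1) 1 0)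
      (psi (x - 1 - 1) 0 0) (psi (x - 1 - 1) 1 0) (psi (x + 1) 1 0) => *; ring.
have a1 : cabs a <= 1 by exact: unitary2_le1.
have d1 : cabs d <= 1 by exact: unitary2_le1.
have nf := hilb_normr_ge0 f.
(* The 4 counts [U0 f], the two translates of [f] and [lambda *: f], each contributing at most
   [n f]. *)
have : cabs (a * d - b * c + lambda ^+ 2) * n psi <=
    (cabs a + cabs d) * n psi + 4 * n f.
  rewrite /cabs -hilb_normrZ -!/(cabs _) key.
  apply: le_trans (hilb_normrB _ _) _; apply: lerD.
    rewrite hilb_normrZ -/(cabs _) lambda1 mul1r.
    apply: le_trans (hilb_normrD _ _) _.
    by rewrite !hilb_normrZ -!/(cabs _) !hilb_normr_trans mulrDl.
  apply: le_trans (hilb_normrD _ _) _.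
  rewrite (hilb_normrZ lambda) -/(cabs _) lambda1 mul1r.
  have h1 : n (U0 f - a *: trans_op 1 f) <= n f + cabs a * n f.
    apply: le_trans (hilb_normrB _ _) _.
    by rewrite (walk_isometry U0E) hilb_normrZ hilb_normr_trans.
  have h2 : n (U0 f - a *: trans_op 1 f - d *: trans_op (-1) f) <=
      n f + cabs a * n f + cabs d * n f.
    apply: le_trans (hilb_normrB _ _) _; apply: lerD => //.
    by rewrite hilb_normrZ hilb_normr_trans.
  have h3 : cabs a * n f <= n f by rewrite ler_piMl.
  have h4 : cabs d * n f <= n f by rewrite ler_piMl.
  clear - h2 h3 h4; apply: le_trans (lerD h2 (lexx _)) _.
  move: (n f) (cabs a * _) (cabs d * _) h3 h4 => {h2} *; lra.
rewrite mulrAC ler_pdivrMr// !mulrBl mulrDl => h.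
by rewrite 2!lerBlDr (mulrC (n f)) [leRHS]addrC (addrC (4 * _)) [leRHS]addrA.
Qed.

Variables (A : int -> unitary2 R) (U : {linear hilb R -> hilb R}).
Hypothesis UE : forall psi, U psi = shift_op (coin_op A psi).
Variable delta : R.
Hypothesis delta0 : 0 < delta.
Hypothesis A_ge : forall x, delta <= cabs (A x 0 0).
Hypothesis A_lim : forall e : R, 0 < e -> exists t : seq int,
  forall x, x \notin t -> forall i j, cabs (A x i j - A0 i j) <= e.

Lemma walk_sub psi : U psi - U0 psi =
  shift_op (coin_op A psi - coin_op (fun=> A0) psi).
Proof. by rewrite linearB UE U0E. Qed.

Lemma coin_subE psi x : (coin_op A psi - coin_op (fun=> A0) psi) x =
  (unitary2_mx (A x) - unitary2_mx A0) *m psi x.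
Proof. by rewrite mulmxBl. Qed.

(** [U0] controls [psi] up to [U - U0]. Off a finite set this difference costs at most [c0 / 2]
    times the norm of [psi] and is absorbed; on the set, the transfer estimates bound [psi] by its
    value at 0 and the residual. *)
Lemma a_priori_estimate (c0 : R) : 0 < c0 -> bounded_below U0 lambda c0 ->
  exists2 C, 0 < C & forall psi,
    n psi <= C * (abs2 (psi 0) + n (U psi - lambda *: psi)).
Proof.
move=> c00 hb.
(* An entrywise bound [c0 / 4] yields an operator bound [c0 / 2] by [sqnormC2_mul]. *)
have [|t ht] := A_lim (e := c0 / 4); first by rewrite divr_gt0.
have [L L0 hL] := transfer_box UE lambda1 delta0 A_ge 0 t.
pose B := 4 * L * (size t).+1%:R.
have B0 : 0 <= B by rewrite !mulr_ge0.
exists (2 * (1 + B) / c0); first by rewrite divr_gt0// mulr_gt0// ltr_pwDl.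
move=> psi; set f := U psi - lambda *: psi; set P := abs2 (psi 0) + n f.
have P0 : 0 <= P by rewrite addr_ge0 ?abs2_ge0 ?hilb_normr_ge0.
have fP : n f <= P by rewrite lerDr abs2_ge0.
have npsi := hilb_normr_ge0 psi.
have hD : n (U psi - U0 psi) <= c0 / 2 * n psi + B * P.
  rewrite -ler_sqr ?nnegrE ?hilb_normr_ge0 ?addr_ge0 ?mulr_ge0 ?invr_ge0 ?(ltW c00)//.
  rewrite walk_sub hilb_normr_shift.
  apply: (@le_trans _ _ ((c0 / 2) ^+ 2 * n psi ^+ 2 + (4 * L * P) ^+ 2 *+ size t)).
    apply: sqr_hilb_normr_le_fin; rewrite ?sqr_ge0// => x.
    rewrite coin_subE; case: ifPn => xt.
      apply: (@le_trans _ _ (4 * 2 ^+ 2 * sqnormC2 (psi x))).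
        apply: sqnormC2_mul => i j; rewrite !mxE.
        apply: le_trans (le_cabsD _ _) _; rewrite cabsN.
        by have := unitary2_le1 (A x) i j; have := unitary2_le1 A0 i j; lra.
      apply: (@le_trans _ _ ((4 * L * P) ^+ 2)); last first.
        by rewrite lerDr mulr_ge0 ?sqr_ge0 ?sqnormC2_ge0.
      have -> : (4 * L * P) ^+ 2 = 4 * 2 ^+ 2 * (L * P) ^+ 2 by ring.
      rewrite ler_wpM2l//; apply: le_trans (sqnormC2_le_abs2 _) _.
      by rewrite ler_sqr ?nnegrE ?abs2_ge0 ?mulr_ge0//; exact: hL.
    rewrite addr0 (_ : (c0 / 2) ^+ 2 = 4 * (c0 / 4) ^+ 2); last by field.
    by apply: sqnormC2_mul => i j; rewrite !mxE; exact: ht.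
  have sz : (4 * L * P) ^+ 2 *+ size t <= (B * P) ^+ 2.
    rewrite -mulr_natl /B.
    have -> : (4 * L * (size t).+1%:R * P) ^+ 2 = (size t).+1%:R ^+ 2 * (4 * L * P) ^+ 2.
      by ring.
    rewrite ler_wpM2r ?sqr_ge0// -natrX ler_nat.
    by apply: leq_trans (leqnSn _) _; rewrite expnS expn1 leq_pmulr.
  rewrite sqrrD -exprMn -addrA lerD2l; apply: le_trans sz _.
  by rewrite lerDr mulrn_wge0// !mulr_ge0 ?invr_ge0 ?(ltW c00).
have h1 : c0 * n psi <= n f + n (U psi - U0 psi).
  apply: le_trans (hb psi) _.
  have -> : U0 psi - lambda *: psi = f - (U psi - U0 psi).
    by rewrite /f opprB [RHS]addrC addrA subrK.
  exact: hilb_normrB.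
rewrite mulrAC ler_pdivlMr//.
have : c0 * n psi <= P + (c0 / 2 * n psi + B * P) by lra.
lra.
Qed.

Hypothesis gap : cabs (A0 0 0) + cabs (A0 1 1) <
  cabs (A0 0 0 * A0 1 1 - A0 0 1 * A0 1 0 + lambda ^+ 2).

Lemma gap_estimate : exists2 C, 0 < C & forall psi,
  n psi <= C * (abs2 (psi 0) + n (U psi - lambda *: psi)).
Proof.
apply: a_priori_estimate constant_walk_bounded_below.
by rewrite divr_gt0// subr_gt0 ltrBrDl.
Qed.

(* Three points of the spectrum close to [lambda] have almost independent
   approximate eigenvectors, some combination of which vanishes at [0] and
   contradicts [gap_estimate]. *)
Lemma gap_isolated : spectrum U lambda -> isolated (spectrum U) lambda.
Proof.
move=> sl; have [C C0 hC] := gap_estimate.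
have Uiso := walk_isometry UE; have Usurj := walk_surj UE.
apply/isolatedP; split=> //; apply: contrapT => no_e.
have near_pt (e : R) : 0 < e ->
    exists2 mu, spectrum U mu & mu != lambda /\ cabs (mu - lambda) < e.
  move=> e0; apply: contrapT => no; apply: no_e.
  exists e%:C => [|mu smu]; first by rewrite ltcR.
  rewrite cabsE ltcR => mul; apply: contrapT => /eqP ne.
  by apply: no; exists mu.
(* Chosen so that [C * (2 * e) = 1 / 12]: three coefficients, each at most [S / 12 + S / 6], would
   give [S <= 3 / 4 * S]. *)
pose e := 1 / (24 * C).
have e0 : 0 < e by rewrite divr_gt0// mulr_gt0.
have [mu1 s1 [ne1 d1]] := near_pt e e0.
(* Taking [mu2] closer to [lambda] than [mu1] makes the three points distinct. *)
have [|mu2 s2 [ne2]] := near_pt (Num.min e (cabs (mu1 - lambda))).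
  by rewrite lt_min e0 cabs_gt0 subr_eq0.
rewrite lt_min => /andP[d2 d21].
pose mu (i : 'I_3) := nth lambda [:: mu1; mu2] i.
have ne12 : mu1 != mu2 by apply: contraTneq d21 => ->; rewrite ltxx.
have mu_inj : injective mu.
  move=> [[|[|[|//]]] ?] [[|[|[|//]]] ?] //= h; apply: val_inj => //=;
    move: h => /eqP; rewrite /mu /= ?(eq_sym lambda) ?(negbTE ne1) ?(negbTE ne2)
      ?(negbTE ne12) ?(eq_sym mu2) ?(negbTE ne12) //.
have smu i : spectrum U (mu i) by case: i => [[|[|[|//]]] ?].
have dmu i : cabs (mu i - lambda) <= e.
  case: i => [[|[|[|//]]] ?]; rewrite /mu /=; [exact: ltW|exact: ltW|].
  by rewrite subrr cabs0; exact: ltW.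
have mu_1 i : cabs (mu i) = 1 by exact: (spectrum_unit Uiso Usurj).
have k0 : 0 < 1 / 6 :> R by rewrite divr_gt0.
have [eta eta0 heta] := almost_independent Uiso mu_inj mu_1 k0.
have ee0 : 0 < Num.min eta e by rewrite lt_min eta0.
pose psi i := projT1 (cid2 (spectrum_approx_eigenvector Uiso Usurj ee0 (smu i))).
have psi1 i : n (psi i) = 1 by rewrite /psi; case: cid2.
have hpsi i : n (U (psi i) - mu i *: psi i) <= Num.min eta e.
  by rewrite /psi; case: cid2.
have [c [i0 ci0] cpsi] := dependent3 (fun i => psi i 0).
pose phi := \sum_i c i *: psi i; pose S := \sum_i cabs (c i).
have S0 : 0 < S.
  rewrite /S (bigD1 i0)//= ltr_pwDl ?cabs_gt0//.
  by apply: sumr_ge0 => i _; exact: cabs_ge0.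
have phi0 : phi 0 = 0.
  rewrite -cpsi /phi; elim/big_rec2: _ => [//|i v w _ <-].
  by rewrite hilbDE hilbZE.
have nphi : n phi <= C * (2 * e * S).
  apply: le_trans (hC phi) _; rewrite ler_pM2l// phi0 /abs2 !mxE cabs0 addr0 add0r.
  have -> : U phi - lambda *: phi = \sum_i c i *: (U (psi i) - lambda *: psi i).
    rewrite /phi linear_sum scaler_sumr -sumrB; apply: eq_bigr => i _.
    by rewrite linearZ scalerBr !scalerA mulrC.
  apply: le_trans (hilb_normr_sum _ _) _; rewrite /S mulr_sumr ler_sum// => i _.
  rewrite hilb_normrZ mulrC ler_wpM2r ?cabs_ge0//.
  have -> : U (psi i) - lambda *: psi i =
      (U (psi i) - mu i *: psi i) + (mu i - lambda) *: psi i.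
    by rewrite scalerBl addrA subrK.
  apply: le_trans (hilb_normrD _ _) _.
  rewrite hilb_normrZ psi1 mulr1 -/(cabs _) (_ : 2 * e = e + e); last by ring.
  by rewrite lerD//; apply: le_trans (hpsi i) _; rewrite ge_min lexx orbT.
have ci i : cabs (c i) <= n phi + 1 / 6 * S.
  apply: heta => // j; apply: le_trans (hpsi j) _; by rewrite ge_min lexx.
have S3 : S <= 3 * (n phi + 1 / 6 * S).
  rewrite /S; apply: le_trans (ler_sum _ (fun i _ => ci i)) _.
  by rewrite sumr_const card_ord mulr_natl.
have Ce : C * (2 * e * S) = S / 12.
  by rewrite /e; field; rewrite gt_eqF.
by rewrite Ce in nphi; lra.
Qed.

(** Evaluation at 0 is injective on the eigenspace by [eigenvector_eq0], so the dimension is at most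
    that of [C^2]. The cases are whether two, one or no independent eigenvectors exist. *)
Lemma eigenspace_finite_multiplicity : finite_multiplicity U lambda.
Proof.
have eig0 := @eigenvector_eq0 _ _ _ UE _ lambda1 _ delta0 A_ge.
have [[psi1 [psi2 [e1 e2 free]]]|nfree] := pselect (exists psi1 psi2 : hilb R,
  [/\ U psi1 = lambda *: psi1, U psi2 = lambda *: psi2 &
   forall c1 c2 : R[i], c1 *: psi1 + c2 *: psi2 = 0 -> c1 = 0 /\ c2 = 0]).
  exists 2%N, (fun i => if i == 0 then psi1 else psi2) => psi e.
  have [c [i0 ci0] cpsi] := dependent3 (fun i => nth psi [:: psi1; psi2] i 0).
  move: cpsi; rewrite !big_ord_recl big_ord0 addr0 /= => cpsi.
  set c1 := c ord0 in cpsi; set c2 := c (lift ord0 ord0) in cpsi.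
  set c3 := c (lift ord0 (lift ord0 ord0)) in cpsi.
  have dep : c1 *: psi1 + (c2 *: psi2 + c3 *: psi) = 0.
    apply: (eig0 _ 0); last exact: cpsi.
    by rewrite [U (_ + _)]linearD [U (_ + _)]linearD ![U (_ *: _)]linearZ /= e e1 e2 !scalerDr !scalerA !(mulrC lambda).
  have c30 : c3 != 0.
    apply/eqP => c30; move: dep; rewrite c30 scale0r addr0 => /free[c10 c20].
    case/negP: ci0; apply/eqP.
    case: i0 => [[|[|[|//]]] ?]; [rewrite -[RHS]c10|rewrite -[RHS]c20|rewrite -[RHS]c30];
      congr c; exact: val_inj.
  exists (fun i => if i == 0 then - c1 / c3 else - c2 / c3).
  rewrite big_ord_recl big_ord1 /=.
  apply: (scalerI c30); rewrite scalerDr !scalerA ![c3 * _]mulrC !divfK//.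
  apply/eqP; rewrite -subr_eq0 -dep !scaleNr opprD !opprK; apply/eqP.
  by rewrite addrC -addrA.
have [[psi1 e1 psi10]|all0] := pselect (exists2 psi1 : hilb R,
    U psi1 = lambda *: psi1 & psi1 != 0).
  exists 1%N, (fun=> psi1) => psi e.
  apply: contrapT => no; apply: nfree; exists psi1, psi; split=> // c1 c2 h.
  have c20 : c2 = 0.
    apply: contrapT => /eqP c20; apply: no; exists (fun=> - c1 / c2).
    rewrite big_ord1; apply: (scalerI c20); rewrite scalerA [c2 * _]mulrC divfK//.
    by apply/eqP; rewrite -subr_eq0 -h scaleNr opprK addrC.
  split=> //; move: h; rewrite c20 scale0r addr0 => /eqP.
  by rewrite scaler_eq0 (negbTE psi10) orbF => /eqP.
exists 0%N, (fun=> 0) => psi e; exists (fun=> 0); rewrite big_ord0.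
by apply: contrapT => /eqP psi0; apply: all0; exists psi.
Qed.

Lemma gap_discrete : is_eigenvalue U lambda -> disc_spectrum U lambda.
Proof.
move=> h; split=> //; last exact: eigenspace_finite_multiplicity.
exact/gap_isolated/(eigenvalue_spectrum (walk_isometry UE) (walk_surj UE)).
Qed.

End gap.

(** * Inside the bands: truncated plane waves as approximate eigenvectors *)

Section plane_waves.
Context {R : realType}.
Local Notation n := (@hilb_normr R).
Variables (A0 : unitary2 R) (U0 : {linear hilb R -> hilb R}).
Hypothesis U0E : forall psi, U0 psi = shift_op (coin_op (fun=> A0) psi).
Variables (lambda z : R[i]) (v : 'cV[R[i]]_2).
Hypothesis lambda1 : cabs lambda = 1.
Hypothesis z1 : cabs z = 1.
Hypothesis v_neq0 : v != 0.
(* That is, [x |-> z ^ x *: v] is a bounded solution of [U0 psi = lambda psi]. *)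
Hypothesis wave0 : z * (A0 0 0 * v 0 0 + A0 0 1 * v 1 0) = lambda * v 0 0.
Hypothesis wave1 : A0 1 0 * v 0 0 + A0 1 1 * v 1 0 = lambda * z * v 1 0.

Section window.
Variables (m : int) (L : nat).

(** Starting the phase at [m] keeps the exponent a natural number. *)
Definition window_fun x : 'cV[R[i]]_2 :=
  if (m <= x < m + L%:Z) then z ^+ `|x - m|%N *: v else 0.

Lemma sqnormC2_window x : sqnormC2 (window_fun x) =
  if (m <= x < m + L%:Z) then sqnormC2 v else 0.
Proof.
rewrite /window_fun; case: ifP => _; last by rewrite sqnormC20.
by rewrite sqnormC2Z -/(cabs _) cabsX z1 !expr1n mul1r.
Qed.

Let window_seq : seq int := [seq m + j%:Z | j <- iota 0 L].

Let mem_window x : (x \in window_seq) = (m <= x < m + L%:Z).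
Proof.
apply/mapP/idP => [[j]|/andP[mx xL]].
  by rewrite mem_iota add0n => /andP[_ jL] ->; lia.
by exists `|x - m|%N; rewrite ?mem_iota; lia.
Qed.

Lemma window_ell2 : window_fun \in ell2.
Proof.
apply: (@finite_support_ell2 _ _ window_seq (sqnormC2 v)).
  exact: sqnormC2_ge0.
by move=> x; rewrite sqnormC2_window mem_window.
Qed.

Definition window : hilb R := Hilb window_ell2.

Lemma window_norm_ge : L%:R * sqnormC2 v <= n window ^+ 2.
Proof.
have us : uniq window_seq.
  by rewrite map_inj_uniq ?iota_uniq// => i j /addrI [].
apply: le_trans (sum_sqnormC2_le window us).
rewrite big_seq (eq_bigr (fun=> sqnormC2 v)); last first.
  by move=> x; rewrite mem_window sqnormC2_window => ->.
by rewrite -big_seq big_const_seq count_predT iter_addr_0 size_map size_iota mulr_natl.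
Qed.

(** The residual lives on four sites at the two ends, each carrying at most [2 * 2 + 2 = 6] times
    [sqnormC2 v], whatever the length [L]. *)
Lemma window_defect : n (U0 window - lambda *: window) ^+ 2 <= 24 * sqnormC2 v.
Proof.
pose t : seq int := [:: m - 1; m; m + L%:Z - 1; m + L%:Z].
have -> : 24 * sqnormC2 v = 0 * n window ^+ 2 + (6 * sqnormC2 v) *+ size t.
  by rewrite -mulr_natl /=; ring.
have v0 := sqnormC2_ge0 v.
apply: sqr_hilb_normr_le_fin; rewrite ?mulr_ge0// => x.
rewrite mul0r add0r; case: ifPn => xt.
  have le_v y : sqnormC2 (window y) <= sqnormC2 v.
    by rewrite sqnormC2_window; case: ifP.
  rewrite hilbDE hilbNE hilbZE; apply: le_trans (sqnormC2D _ _ ltr01) _.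
  rewrite invr1 -scaleNr sqnormC2Z -/(cabs _) cabsN lambda1 expr1n mul1r.
  have : sqnormC2 (U0 window x) <= 2 * sqnormC2 v.
    rewrite sqnormC2_cabs (walk_E0 U0E) (walk_E1 U0E) -!mulmx2E.
    apply: (@le_trans _ _ (sqnormC2 (A0 *m window (x + 1)) + sqnormC2 (A0 *m window (x - 1)))).
      by apply: lerD; rewrite sqnormC2_cabs ?lerDl ?lerDr sqr_ge0.
    rewrite !sqnormC2_unitary; have := le_v (x + 1); have := le_v (x - 1); lra.
  have := le_v x; lra.
suff -> : (U0 window - lambda *: window) x = 0 by rewrite sqnormC20.
move: xt; rewrite !inE !negb_or => /and4P[x1 x2 x3 x4].
apply: cV2P; rewrite hilbDE hilbNE hilbZE !mxE ?(walk_E0 U0E) ?(walk_E1 U0E) /=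
  /window_fun.
- have -> : (m <= x + 1 < m + L%:Z) = (m <= x < m + L%:Z) by lia.
  case: ifP => [xL|_]; last by rewrite !mxE !mulr0 addr0 subrr.
  have -> : `|(x + 1)%R - m|%N = `|x - m|%N.+1 by lia.
  rewrite !mxE exprSr.
  have -> : A0 0 0 * (z ^+ `|x - m| * z * v 0 0) +
    A0 0 1 * (z ^+ `|x - m| * z * v 1 0) =
    z ^+ `|x - m| * (z * (A0 0 0 * v 0 0 + A0 0 1 * v 1 0)) by ring.
  by rewrite wave0 mulrCA subrr.
- have -> : (m <= x - 1 < m + L%:Z) = (m <= x < m + L%:Z) by lia.
  case: ifP => [xL|_]; last by rewrite !mxE !mulr0 addr0 subrr.
  have -> : `|x - m|%N = `|(x - 1)%R - m|%N.+1 by lia.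
  rewrite !mxE; set y := `|_ - m|%N.
  have -> : A0 1 0 * (z ^+ y * v 0 0) + A0 1 1 * (z ^+ y * v 1 0) =
    z ^+ y * (A0 1 0 * v 0 0 + A0 1 1 * v 1 0) by ring.
  by rewrite wave1 exprSr; ring.
Qed.

End window.

Variables (A : int -> unitary2 R) (U : {linear hilb R -> hilb R}).
Hypothesis UE : forall psi, U psi = shift_op (coin_op A psi).
Hypothesis A_lim : forall e : R, 0 < e -> exists t : seq int,
  forall x, x \notin t -> forall i j, cabs (A x i j - A0 i j) <= e.

(** The norm of a window grows with its length while its residual stays bounded, and far to the
    right [U] is close to [U0]; hence no lower bound can hold. *)
Lemma plane_wave_spectrum : spectrum U lambda.
Proof.
apply/(spectrumP (walk_isometry UE) (walk_surj UE)) => c c0 hb.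
have [|t ht] := A_lim (e := c / 8); first by rewrite divr_gt0.
have [m hm] : exists m : int, forall x, m <= x -> x \notin t.
  elim: t {ht} => [|y t [m hm]]; first by exists 0.
  exists (Num.max m (y + 1)) => x; rewrite ge_max => /andP[mx yx].
  by rewrite inE negb_or hm// andbT; lia.
(* This length brings the residual for [U0] below [c / 4] relative to the norm; replacing [U0] by
   [U] costs another [c / 4]. *)
pose L := (Num.trunc (24 * (4 / c) ^+ 2)).+1.
have Lc : 24 <= (c / 4) ^+ 2 * L%:R.
  have : 24 * (4 / c) ^+ 2 <= L%:R by exact/ltW/truncnS_gt.
  rewrite (_ : (4 / c) ^+ 2 = ((c / 4) ^+ 2)^-1); last by rewrite -exprVn invf_div.
  by rewrite ler_pdivrMr ?exprn_gt0 ?divr_gt0// mulrC.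
pose psi := window m L.
have v0 := sqnormC2_gt0 v_neq0.
have psi0 : 0 < n psi.
  rewrite lt_def hilb_normr_ge0 andbT; apply/eqP => e.
  have := window_norm_ge m L; rewrite -/psi e expr0n leNgt.
  by rewrite mulr_gt0 ?ltr0n.
have c4 : 0 <= c / 4 * n psi by rewrite mulr_ge0 ?hilb_normr_ge0// divr_ge0// ltW.
have h1 : n (U0 psi - lambda *: psi) <= c / 4 * n psi.
  rewrite -ler_sqr ?nnegrE ?hilb_normr_ge0//; apply: le_trans (window_defect _ _) _.
  rewrite exprMn; apply: (@le_trans _ _ ((c / 4) ^+ 2 * (L%:R * sqnormC2 v))).
    by rewrite mulrA ler_wpM2r// ltW.
  by rewrite ler_wpM2l ?sqr_ge0// window_norm_ge.
have h2 : n (U psi - U0 psi) <= c / 4 * n psi.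
  rewrite -ler_sqr ?nnegrE ?hilb_normr_ge0//.
  rewrite (walk_sub U0E UE) hilb_normr_shift exprMn.
  rewrite -[leRHS](addr0 ((c / 4) ^+ 2 * n psi ^+ 2)) -(mul0rn R (size ([::] : seq int))).
  apply: (@sqr_hilb_normr_le_fin _ _ _ _ _ [::]); rewrite ?sqr_ge0// => x.
  rewrite coin_subE addr0.
  case: (boolP (m <= x < m + L%:Z)) => [/andP[mx _]|xL]; last first.
    have -> : psi x = 0 by rewrite /psi /= /window_fun (negbTE xL).
    by rewrite mulmx0 sqnormC20 mulr0.
  rewrite (_ : (c / 4) ^+ 2 = 4 * (c / 8) ^+ 2); last by field.
  by apply: sqnormC2_mul => i j; rewrite !mxE; apply: ht; exact: hm.
have := hb psi; rewrite (_ : U psi - lambda *: psi =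
  (U psi - U0 psi) + (U0 psi - lambda *: psi)); last by rewrite addrA subrK.
move=> /le_trans /(_ (hilb_normrD _ _)).
have : 0 < c * n psi by rewrite mulr_gt0.
lra.
Qed.

End plane_waves.

(** * Perturbed recurrences governed by an elliptic matrix *)

Section elliptic_recurrence.
Context {R : realType}.
Variables (T : 'M[R[i]]_2) (omega : R[i]) (t : R).
Hypothesis omega1 : cabs omega = 1.
Hypothesis t1 : `|t| < 1.
(** Ellipticity: the annihilating polynomial [X^2 - 2 t omega X + omega^2] has the distinct
    unimodular roots [omega (t +/- i sqrt (1 - t^2))]. *)
Hypothesis TT : T *m T = ((2 * t)%:C * omega) *: T - (omega ^+ 2)%:M.

Let N := T - (t%:C * omega)%:M.
(* The positive definite form preserved by the elliptic matrix [T]. *)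
Let Q (v : 'cV[R[i]]_2) := sqnormC2 (N *m v) + (1 - t ^+ 2) * sqnormC2 v.

Let t2 : 0 < 1 - t ^+ 2.
Proof. by rewrite subr_gt0 -real_normK ?num_real// expr_lt1. Qed.

Let Q_ge v : (1 - t ^+ 2) * sqnormC2 v <= Q v.
Proof. by rewrite lerDr sqnormC2_ge0. Qed.

Let Q_ge0 v : 0 <= Q v.
Proof. by apply: le_trans (Q_ge v); rewrite mulr_ge0 ?sqnormC2_ge0 ?ltW. Qed.

Let Q_le : exists2 C, 0 < C & forall v, Q v <= C * sqnormC2 v.
Proof.
pose e := \sum_i \sum_j cabs (N i j).
have e0 : 0 <= e by do 2!apply: sumr_ge0 => ? _; exact: cabs_ge0.
exists (4 * e ^+ 2 + (1 - t ^+ 2)); first by rewrite ltr_wpDl// mulr_ge0 ?sqr_ge0.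
move=> v; rewrite mulrDl lerD2r; apply: sqnormC2_mul => i j.
rewrite /e (bigD1 i)//= (bigD1 j)//= -addrA lerDl addr_ge0//.
  by apply: sumr_ge0 => ? _; exact: cabs_ge0.
by do 2!apply: sumr_ge0 => ? _; exact: cabs_ge0.
Qed.

(** With [w = T v] and [u = omega v], both sides equal [|w|^2 + |u|^2 - 2 t Re <w, u>]. *)
Let Q_invariant v : Q (T *m v) = Q v.
Proof.
rewrite /Q; set w := T *m v.
have -> : N *m w = omega *: (t%:C *: w - omega *: v).
  have -> : N *m w = T *m w - (t%:C * omega) *: w by rewrite mulmxBl mul_scalar_mx.
  have -> : T *m w = ((2 * t)%:C * omega) *: w - (omega ^+ 2) *: v.
    by rewrite /w mulmxA TT mulmxBl mul_scalar_mx -scalemxAl.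
  rewrite (_ : 2 * t = t + t) ?rmorphD; last by ring.
  by apply/matrixP => i j; rewrite !mxE; move: ((T *m v) i j) => ?; ring.
have -> : N *m v = w - (t%:C * omega) *: v by rewrite mulmxBl mul_scalar_mx.
rewrite sqnormC2Z -/(cabs _) omega1 expr1n mul1r.
have -> : sqnormC2 v = sqnormC2 (omega *: v).
  by rewrite sqnormC2Z -/(cabs _) omega1 expr1n mul1r.
rewrite -scalerA; move: w (omega *: v) => w u.
rewrite !sqnormC2_cabs !mxE !sqr_cabs.
case: (w 0 0) (w 1 0) (u 0 0) (u 1 0) => [? ?] [? ?] [? ?] [? ?] /=.
ring.
Qed.

Let QD (s : R) v w : 0 < s -> Q (v + w) <= (1 + s) * Q v + (1 + s^-1) * Q w.
Proof.
move=> s0; rewrite /Q mulmxDr.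
have h1 := sqnormC2D (N *m v) (N *m w) s0.
have h2 : (1 - t ^+ 2) * sqnormC2 (v + w) <= (1 - t ^+ 2) *
    ((1 + s) * sqnormC2 v + (1 + s^-1) * sqnormC2 w).
  by rewrite ler_wpM2l ?(ltW t2)// sqnormC2D.
apply: le_trans (lerD h1 h2) _.
by rewrite le_eqVlt; apply/orP; left; apply/eqP; ring.
Qed.

(** Apply [QD] to [T v = w - (w - T v)] and the invariance of [Q], then use
    [(1 + s) (1 - 2 s) <= 1 - s - s^2]. *)
Let Q_perturb (s : R) v w : 0 < s -> Q (w - T *m v) <= s ^+ 2 * Q v ->
  (1 - 2 * s) * Q v <= Q w.
Proof.
move=> s0 h.
have QN u : Q (- u) = Q u.
  have N1 u' : sqnormC2 (- u') = sqnormC2 u'.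
    by rewrite -scaleN1r sqnormC2Z -/(cabs _) cabsN cabs1 expr1n mul1r.
  by rewrite /Q mulmxN !N1.
have := QD w (- (w - T *m v)) s0.
rewrite QN opprB (_ : w + (T *m v - w) = T *m v) ?Q_invariant => [h1|]; last first.
  by rewrite addrC subrK.
have h2 : (1 + s^-1) * Q (w - T *m v) <= (s ^+ 2 + s) * Q v.
  have -> : s ^+ 2 + s = (1 + s^-1) * s ^+ 2 by field; rewrite gt_eqF.
  by rewrite -mulrA ler_wpM2l// addr_ge0// invr_ge0 ltW.
have h3 : (1 - s - s ^+ 2) * Q v <= (1 + s) * Q w.
  rewrite !mulrBl mul1r -addrA -opprD lerBlDr; apply: le_trans h1 _.
  by rewrite lerD2l [s * _ + _]addrC -mulrDl.
have s1 : 0 < 1 + s by rewrite addr_gt0.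
rewrite -(ler_pM2l s1); apply: le_trans h3.
rewrite mulrA ler_wpM2r// -subr_ge0.
by rewrite (_ : _ - _ = s ^+ 2) ?sqr_ge0//; ring.
Qed.

(* [Q (f k)] changes by factors [1 + O(r ^+ k)], whose product converges. *)
Lemma elliptic_recurrence_lower_bound (f : nat -> 'cV[R[i]]_2) (kappa r : R) :
  0 < kappa -> 0 < r < 1 ->
  (forall k, sqnormC2 (f k.+1 - T *m f k) <= (kappa * r ^+ k) ^+ 2 * sqnormC2 (f k)) ->
  exists k0, exists2 c, 0 < c &
    forall j, c * sqnormC2 (f k0) <= sqnormC2 (f (k0 + j)%N).
Proof.
move=> kappa0 /andP[r0 r1] hf; have [C C0 hC] := Q_le.
(* The square root pays for passing between [Q] and [sqnormC2], whose ratio lies between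
   [1 - t ^+ 2] and [C]. *)
pose D := Num.sqrt (C / (1 - t ^+ 2)) * kappa.
have D0 : 0 < D by rewrite mulr_gt0// sqrtr_gt0 divr_gt0.
have step k : (1 - 2 * (D * r ^+ k)) * Q (f k) <= Q (f k.+1).
  apply: Q_perturb; first by rewrite mulr_gt0// exprn_gt0.
  apply: le_trans (hC _) _.
  apply: (@le_trans _ _ (C * ((kappa * r ^+ k) ^+ 2 * sqnormC2 (f k)))).
    by rewrite ler_pM2l.
  have -> : (D * r ^+ k) ^+ 2 = C / (1 - t ^+ 2) * (kappa * r ^+ k) ^+ 2.
    by rewrite /D -mulrA exprMn sqr_sqrtr ?divr_ge0 ?ltW.
  rewrite [leRHS](_ : _ = C * ((kappa * r ^+ k) ^+ 2 * ((1 - t ^+ 2)^-1 * Q (f k)))); last by ring.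
  rewrite ler_pM2l// ler_wpM2l ?sqr_ge0//.
  by rewrite -ler_pdivrMl ?invr_gt0// invrK.
have r01 : 0 <= r < 1 by rewrite ltW.
(* [k0] makes [B], the sum of [2 * D * r ^+ k] over all [k >= k0], at most [1 / 2]. *)
have [//|k0 hk0] := @geometric_small _ r (2 * D / (1 - r)) (1 / 2) r01.
have {hk0} := hk0 k0 (leqnn _); set B := _ * r ^+ k0 => B2.
have dr : 0 < 1 - r by rewrite subr_gt0.
have B0 : 0 <= B by rewrite mulr_ge0 ?exprn_ge0 ?(ltW r0)// divr_ge0 ?(ltW dr)// mulr_ge0// ltW.
have BE j : 2 * (D * r ^+ (k0 + j)) = B * (1 - r) * r ^+ j.
  by rewrite exprD /B; field; rewrite gt_eqF.
clearbody B.
have rj j : 0 <= r ^+ j <= 1 by rewrite exprn_ge0 ?exprn_ile1 ?ltW.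
(* A product of factors [1 - x_i] is at least one minus the sum of the [x_i]; the first [j] terms
   sum to [B * (1 - r ^+ j)]. *)
have low j : (1 - B * (1 - r ^+ j)) * Q (f k0) <= Q (f (k0 + j)%N).
  elim: j => [|j IH]; first by rewrite addn0 expr0 subrr mulr0 subr0 mul1r.
  have := step (k0 + j)%N; rewrite BE -addnS; apply: le_trans.
  have /andP[rj0 rj1] := rj j.
  have x0 : 0 <= B * (1 - r) * r ^+ j by rewrite !mulr_ge0// ltW.
  have x1 : B * (1 - r) * r ^+ j <= 1.
    apply: (@le_trans _ _ (B * 1 * 1)); last by rewrite !mulr1; lra.
    by rewrite ler_pM ?mulr_ge0 ?(ltW dr)// ler_wpM2l//; lra.
  have y0 : 0 <= B * (1 - r ^+ j) by rewrite mulr_ge0// subr_ge0.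
  apply: (@le_trans _ _ ((1 - B * (1 - r) * r ^+ j) * ((1 - B * (1 - r ^+ j)) * Q (f k0)))).
    rewrite mulrA ler_wpM2r// exprS -subr_ge0.
    rewrite (_ : _ - _ = (B * (1 - r) * r ^+ j) * (B * (1 - r ^+ j))); last by ring.
    by rewrite mulr_ge0.
  by rewrite ler_wpM2l// subr_ge0.
exists k0, ((1 - t ^+ 2) / (2 * C)); first by rewrite divr_gt0// mulr_gt0.
move=> j; rewrite mulrAC ler_pdivrMr ?mulr_gt0//.
apply: le_trans (Q_ge _) _; rewrite mulrC -mulrA.
apply: (@le_trans _ _ (2 * Q (f (k0 + j)%N))); last by rewrite ler_pM2l.
apply: (@le_trans _ _ (2 * ((1 - B * (1 - r ^+ j)) * Q (f k0)))); last by rewrite ler_pM2l.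
rewrite mulrA ler_peMl//.
have /andP[rj0 rj1] := rj j.
have : B * (1 - r ^+ j) <= 1 / 2 by apply: le_trans B2; rewrite ler_piMr//; lra.
lra.
Qed.

End elliptic_recurrence.

(** * Inside the bands: square-summable eigenfunctions vanish *)

Section no_embedded_eigenvalue.
Context {R : realType}.
Local Notation n := (@hilb_normr R).
Variables (A : int -> unitary2 R) (U : {linear hilb R -> hilb R}).
Hypothesis UE : forall psi, U psi = shift_op (coin_op A psi).
Variables (A0 : 'M[R[i]]_2) (lambda omega : R[i]) (t : R).
Hypothesis lambda1 : cabs lambda = 1.
Hypothesis omega1 : cabs omega = 1.
Hypothesis t1 : `|t| < 1.
Variable delta : R.
Hypothesis delta0 : 0 < delta.
Hypothesis A_ge : forall x, delta <= cabs (A x 0 0).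
Hypothesis A0_neq0 : A0 0 0 != 0.
Hypothesis A0_det : A0 1 1 = omega ^+ 2 * A0 0 0.
Hypothesis A0_trace : lambda ^+ 2 + (A0 0 0 * A0 1 1 - A0 0 1 * A0 1 0) =
  (2 * t)%:C * omega * A0 0 0 * lambda.
Variables (kappa r : R).
Hypothesis kappa0 : 0 < kappa.
Hypothesis r01 : 0 < r < 1.
Hypothesis A_decay : forall (k : nat) i j,
  cabs (A k%:Z i j - A0 i j) <= kappa * r ^+ k.

Let l0 : lambda != 0. Proof. exact: cabs_eq1_neq0. Qed.

(** Solves the eigenvalue equation with constant coin for the next site: component 1 first, then
    component 0 after division by [a]. *)
Definition transfer_mx : 'M[R[i]]_2 :=
  let a := A0 0 0 in let b := A0 0 1 in let c := A0 1 0 in let d := A0 1 1 in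
  mx2 ((lambda - b * (c / lambda)) / a) (- b * (d / lambda) / a)
      (c / lambda) (d / lambda).

(** Cayley-Hamilton: the trace is [(lambda^2 + det A0) / (a lambda)] and the determinant is [d / a],
    identified by the hypotheses with [2 t omega] and [omega^2]. *)
Lemma transfer_mx_CH : transfer_mx *m transfer_mx =
  ((2 * t)%:C * omega) *: transfer_mx - (omega ^+ 2)%:M.
Proof.
have e1 : (2 * t)%:C * omega =
    (lambda ^+ 2 + (A0 0 0 * A0 1 1 - A0 0 1 * A0 1 0)) / (A0 0 0 * lambda).
  by rewrite A0_trace; field; rewrite l0 A0_neq0.
have e2 : omega ^+ 2 = A0 1 1 / A0 0 0 by rewrite A0_det mulfK.
rewrite e1 e2 /transfer_mx.
apply/matrixP => i j; rewrite !mxE big_ord_recl big_ord1 !mxE.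
case: i => [[|[|//]] ?]; case: j => [[|[|//]] ?] /=;
  rewrite ?mulr1n ?mulr0n; field; rewrite l0 A0_neq0 //.
Qed.

(** On the right half-line [psi] follows the elliptic recurrence up to a geometric error, so it is
    bounded away from 0 unless it vanishes at [k0]. The former contradicts summability; the latter
    propagates to every site. *)
Lemma eigenvector_decay_eq0 psi : U psi = lambda *: psi -> psi = 0.
Proof.
move=> e.
pose f (k : nat) := psi k%:Z.
have fS k : psi (k%:Z + 1) = f k.+1 by rewrite /f intS addrC.
have /andP[r0 r1] := r01.
pose K := 1 + 2 / delta.
have K1 : 1 <= K by rewrite lerDl divr_ge0// ltW.
have [D D0 hD] : exists2 D, 0 < D & forall k,
    sqnormC2 (f k.+1 - transfer_mx *m f k) <= (D * r ^+ k) ^+ 2 * sqnormC2 (f k).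
  pose a := A0 0 0; pose b := A0 0 1.
  have a0 : 0 < cabs a by rewrite cabs_gt0.
  pose D1 := ((K + cabs b) / cabs a + 1) * kappa.
  have D10 : 0 < D1.
    by rewrite mulr_gt0// ltr_wpDl// divr_ge0 ?cabs_ge0// addr_ge0 ?cabs_ge0//; lra.
  exists (2 * D1); first by rewrite mulr_gt0.
  move=> k; set v := f k; set w := f k.+1; set g := w - transfer_mx *m v.
  pose ek := kappa * r ^+ k.
  have ek0 : 0 <= ek by rewrite mulr_ge0 ?exprn_ge0 ?ltW.
  have wv : abs2 w <= K * abs2 v.
    have := transfer_right UE lambda1 delta0 A_ge psi k%:Z.
    by rewrite e subrr hilb_normr0 addr0 fS.
  have E1 : A k%:Z 1 0 * v 0 0 + A k%:Z 1 1 * v 1 0 = lambda * w 1 0.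
    have := walk_E1 UE psi (k%:Z + 1); rewrite e hilb_scaleE addrK fS.
    by move=> ->.
  have E0 : A k.+1%:Z 0 0 * w 0 0 + A k.+1%:Z 0 1 * w 1 0 = lambda * v 0 0.
    have := walk_E0 UE psi k%:Z; rewrite e hilb_scaleE fS.
    by rewrite (_ : k%:Z + 1 = k.+1%:Z) => [->//|]; rewrite intS addrC.
  have gE i : g i 0 = w i 0 - (transfer_mx *m v) i 0.
    by rewrite /g mxE [X in _ + X]mxE.
  (* Multiplying the recurrence error [g] by [lambda], and by [a] in the other component, clears the
     denominators of [transfer_mx] and exposes the coin differences. *)
  have g1E : lambda * g 1 0 =
      (A k%:Z 1 0 - A0 1 0) * v 0 0 + (A k%:Z 1 1 - A0 1 1) * v 1 0.
    rewrite gE mulmx2E !mxE /= mulrBr -E1.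
    by field; rewrite l0.
  have g0E : a * g 0 0 = (a - A k.+1%:Z 0 0) * w 0 0 +
      (b - A k.+1%:Z 0 1) * w 1 0 - b * g 1 0.
    have -> : (a - A k.+1%:Z 0 0) * w 0 0 + (b - A k.+1%:Z 0 1) * w 1 0 =
        a * w 0 0 + b * w 1 0 - lambda * v 0 0 by rewrite -E0; ring.
    rewrite !gE !mulmx2E !mxE /= -/a -/b.
    by field; rewrite l0 A0_neq0.
  have v0 := abs2_ge0 v; have w0 := abs2_ge0 w.
  have lin (x y : R[i]) (u : 'cV[R[i]]_2) : cabs x <= ek -> cabs y <= ek ->
      cabs (x * u 0 0 + y * u 1 0) <= ek * abs2 u.
    move=> hx hy; apply: le_trans (le_cabsD _ _) _; rewrite !cabsM mulrDr.
    by rewrite lerD// ler_wpM2r ?cabs_ge0.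
  have ekS : kappa * r ^+ k.+1 <= ek.
    rewrite ler_pM2l// exprS ler_piMl ?exprn_ge0 ?(ltW r0)//; exact: ltW.
  have g1 : cabs (g 1 0) <= ek * abs2 v.
    rewrite -[cabs (g 1 0)]mul1r -lambda1 -cabsM g1E.
    by apply: lin; exact: A_decay.
  have g0 : cabs (g 0 0) <= (K + cabs b) / cabs a * (ek * abs2 v).
    rewrite mulrAC ler_pdivlMr// mulrC -cabsM g0E.
    apply: le_trans (le_cabsD _ _) _; rewrite cabsN cabsM (mulrDl K); apply: lerD.
      apply: (@le_trans _ _ (ek * abs2 w)).
        by apply: lin; rewrite cabsB; apply: le_trans ekS; exact: A_decay.
      by rewrite mulrCA ler_wpM2l.
    by rewrite ler_wpM2l ?cabs_ge0.
  have g2 : abs2 g <= D1 * r ^+ k * abs2 v.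
    apply: le_trans (lerD g0 g1) _.
    by rewrite /D1 /ek le_eqVlt; apply/orP; left; apply/eqP; ring.
  apply: le_trans (sqnormC2_le_abs2 _) _.
  apply: (@le_trans _ _ ((D1 * r ^+ k * abs2 v) ^+ 2)).
    rewrite ler_sqr ?nnegrE ?abs2_ge0// mulr_ge0// mulr_ge0 ?exprn_ge0 ?(ltW r0)//.
    exact: ltW.
  have vv : abs2 v ^+ 2 <= 4 * sqnormC2 v.
    rewrite sqnormC2_cabs /abs2 -subr_ge0.
    rewrite (_ : _ - _ = (cabs (v 0 0) - cabs (v 1 0)) ^+ 2 +
       2 * (cabs (v 0 0) ^+ 2 + cabs (v 1 0) ^+ 2)); last by ring.
    apply: addr_ge0; first exact: sqr_ge0.
    by apply: mulr_ge0 => //; rewrite addr_ge0 ?sqr_ge0.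
  rewrite exprMn (_ : (2 * D1 * _) ^+ 2 * _ =
    (D1 * r ^+ k) ^+ 2 * (4 * sqnormC2 v)); last by ring.
  by rewrite ler_wpM2l ?sqr_ge0.
have [k0 [c c0 low]] :=
  elliptic_recurrence_lower_bound omega1 t1 transfer_mx_CH D0 r01 hD.
suff : f k0 = 0 by exact: (eigenvector_eq0 UE lambda1 delta0 A_ge e).
apply/sqnormC2_eq0/eqP; rewrite eq_le sqnormC2_ge0 andbT leNgt; apply/negP => q0.
have cq : 0 < c * sqnormC2 (f k0) by rewrite mulr_gt0.
(* [L] sites, each carrying at least [c * sqnormC2 (f k0)], exceed the total [n psi ^+ 2]. *)
pose L := (Num.trunc (n psi ^+ 2 / (c * sqnormC2 (f k0)))).+1.
have : n psi ^+ 2 < L%:R * (c * sqnormC2 (f k0)).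
  by rewrite -ltr_pdivrMr//; exact: truncnS_gt.
rewrite ltNge => /negP; apply.
pose s : seq int := [seq (k0 + j)%:Z | j <- iota 0 L].
have us : uniq s by rewrite map_inj_uniq ?iota_uniq// => i j [] /addnI.
apply: le_trans (sum_sqnormC2_le psi us).
rewrite big_map; apply: (@le_trans _ _ (\sum_(j <- iota 0 L) c * sqnormC2 (f k0))).
  by rewrite big_const_seq count_predT iter_addr_0 size_iota mulr_natl.
by apply: ler_sum => j _; exact: low.
Qed.

End no_embedded_eigenvalue.

(** * Trigonometry of the bands and thresholds *)

Section trigonometry.
Context {R : realType}.
Implicit Types (p x h theta : R).

Lemma acos_unit p : 0 <= p <= 1 ->
  [/\ cos (acos p) = p, 0 <= acos p & acos p <= pi].
Proof.
move=> /andP[p0 p1]; have pI : -1 <= p <= 1 by rewrite p1 andbT; lra.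
by split; [rewrite acosK// in_itv|exact: acos_ge0|exact: acos_lepi].
Qed.

Lemma cos_piB x : cos (pi - x) = - cos x.
Proof. by rewrite cosB cospi sinpi mul0r addr0 mulN1r. Qed.

Lemma cos_bandP p x : 0 <= p <= 1 -> acos p < x < pi - acos p ->
  `|cos x| < p.
Proof.
move=> p01 /andP[x1 x2]; have [ca a0 api] := acos_unit p01.
rewrite ltr_norml; apply/andP; split.
  by rewrite -ca -cos_piB ltr_cos// in_itv /=; lra.
by rewrite -[ltRHS]ca ltr_cos// in_itv /=; lra.
Qed.

(** The second interval of [J] is the first moved by [pi], which only flips the sign of the cosine;
    avoiding [J_T] makes the inequalities strict. *)
Lemma cos_interior_J p gamma theta : 0 <= p <= 1 ->
  (J p gamma `\` J_T p gamma) theta -> `|cos (theta - gamma / 2)| < p.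
Proof.
move=> p01 [+ nT]; set x := theta - gamma / 2.
have ne y : theta != y + gamma / 2 -> x != y.
  by apply: contra_neq => <-; rewrite /x subrK.
have ext y : J_T p gamma (y + gamma / 2) -> x != y.
  by move=> h; apply: ne; apply: contra_not_neq nT => ->.
rewrite /J /= !in_itv /= => -[|] /andP[h1 h2].
  have n1 : x != acos p by apply: ext; do 3!left.
  have n2 : x != pi - acos p by apply: ext; do 2!left; right.
  by apply: cos_bandP => //; rewrite !lt_def n1 eq_sym n2 /x; lra.
have n1 : x != pi + acos p by apply: ext; left; right.
have n2 : x != 2 * pi - acos p by apply: ext; right.
have -> : cos x = - cos (x - pi) by rewrite -[in LHS](subrK pi x) cosDpi.
rewrite normrN; apply: cos_bandP => //.
have : pi + acos p < x by rewrite lt_def n1 /x; lra.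
have : x < 2 * pi - acos p by rewrite lt_def eq_sym n2 /x; lra.
lra.
Qed.

(** The coordinates of [s] are [p] and [sin (acos p)] up to sign, and the four sign choices are the
    four angles. *)
Lemma expi_thresholds p (s : R[i]) : 0 <= p <= 1 -> cabs s = 1 ->
  `|complex.Re s| = p ->
  exists2 phi, [set acos p; pi - acos p; pi + acos p; 2 * pi - acos p] phi &
    s = expi phi.
Proof.
move=> p01; have [ca a0 api] := acos_unit p01.
case: s => u v s1 /= up.
have uv : u ^+ 2 + v ^+ 2 = 1.
  by have := sqr_cabs (u +i* v); rewrite s1 expr1n.
have v2 : v ^+ 2 = sin (acos p) ^+ 2.
  by rewrite sin2cos2 ca -up real_normK ?num_real// -uv addrAC subrr add0r.
have sgn (a b : R) : a ^+ 2 = b ^+ 2 -> a = b \/ a = - b.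
  by move=> /eqP; rewrite eqf_sqr => /orP[/eqP|/eqP]; [left|right].
have {}up : u = p \/ u = - p.
  by move: up; case: (ger0P u) => _ <-; [left|right; rewrite opprK].
have sB x : sin (pi - x) = sin x.
  by rewrite sinB cospi sinpi mul0r sub0r mulN1r opprK.
have pi2 : 2 * pi = pi + pi :> R by ring.
have [->|->] := up; have [->|->] := sgn _ _ v2.
- by exists (acos p); [do 3!left|rewrite /expi ca].
- exists (2 * pi - acos p); first by right.
  by rewrite /expi pi2 -addrA [pi + _]addrC cosDpi sinDpi cos_piB sB opprK ca.
- exists (pi - acos p); first by do 2!left; right.
  by rewrite /expi cos_piB sB ca.
- exists (pi + acos p); first by left; right.
  by rewrite /expi addrC cosDpi sinDpi ca.
Qed.

Lemma small_rotation (p x e : R) : `|cos x| < p -> 0 < e ->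
  exists h, [/\ `|cos (x + h)| < p, expi h != 1 & cabs (expi h - 1) < e].
Proof.
move=> xp e0.
have c1 : {for 0, continuous (fun h : R => `|cos (x + h)|)}.
  apply: continuous_comp; last exact: norm_continuous.
  apply: continuous_comp; last exact: continuous_cos.
  by apply: cvgD; [exact: cvg_cst|exact: cvg_id].
have c2 : {for 0, continuous (fun h : R => 2 - 2 * cos h)}.
  apply: cvgB; first exact: cvg_cst.
  by apply: cvgMr; exact: continuous_cos.
have n1 : \forall h \near (0 : R)^'+, `|cos (x + h)| < p.
  apply: (@cvg_within _ (nbhs (0 : R)) _).
  by apply: (cvgr_lt _ c1); rewrite addr0.
have n2 : \forall h \near (0 : R)^'+, 2 - 2 * cos h < e ^+ 2.
  apply: (@cvg_within _ (nbhs (0 : R)) _).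
  by apply: (cvgr_lt _ c2); rewrite cos0 mulr1 subrr exprn_gt0.
near (0 : R)^'+ => h.
have h0 : 0 < h by near: h; exact: nbhs_right_gt.
(* The range [0 < h < 2] ensures [sin h > 0], hence [expi h != 1]. *)
have h2 : h < 2 by near: h; exact: nbhs_right_lt.
exists h; split.
- by near: h.
- rewrite eq_complex /= negb_and; apply/orP; right.
  by rewrite gt_eqF//; apply: sin2_gt0; rewrite h0.
- rewrite -ltr_sqr ?nnegrE ?cabs_ge0 ?ltW// sqr_cabs /= subr0.
  have -> : (cos h - 1) ^+ 2 + sin h ^+ 2 = 2 - 2 * cos h.
    have := cos2Dsin2 h; move: (cos h) (sin h) => a b ab.
    lra.
  by near: h.
Unshelve. all: by end_near. Qed.

End trigonometry.

(** * The constant coin: unitarity, trace identities and plane waves *)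

Section constant_coin.
Context {R : realType}.
Variables (p q alpha beta gamma : R).
Hypothesis p01 : 0 < p <= 1.
Hypothesis pq : p ^+ 2 + q ^+ 2 = 1.

Local Notation C0 := (C0 p q alpha beta gamma).
Local Notation e := (expi (gamma / 2)).
Local Notation omega := (expi (gamma / 2 - alpha)).

Let p_gt0 : 0 < p. Proof. by case/andP: p01. Qed.
Let pC : p%:C != 0 :> R[i]. Proof. by rewrite -cabs_eq0 cabs_real normr_eq0 gt_eqF. Qed.

Let C00 : C0 0 0 = p%:C * expi alpha. Proof. by rewrite mxE. Qed.
Let C01 : C0 0 1 = q%:C * expi beta. Proof. by rewrite mxE. Qed.
Let C10 : C0 1 0 = - (q%:C * expi (- (beta - gamma))). Proof. by rewrite mxE. Qed.
Let C11 : C0 1 1 = p%:C * expi (- (alpha - gamma)). Proof. by rewrite mxE. Qed.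

(** Writes the phases as quotients and powers of exponentials, so that [field] can close the
    identities. *)
Let expiE : [/\ expi (- (beta - gamma)) = expi gamma / expi beta :> R[i],
  expi (- (alpha - gamma)) = expi gamma / expi alpha :> R[i],
  omega = e / expi alpha & expi gamma = e ^+ 2].
Proof.
split; rewrite ?opprB ?expiD ?expiN//.
by rewrite expr2 -expiD; congr expi; field.
Qed.

Lemma C0_unitary : C0 \is unitarymx.
Proof.
have E t : Num.conj (expi t) = (expi t)^-1 :> R[i].
  by rewrite -expiN /expi cosN sinN.
have Ec (a : R) : Num.conj (a%:C) = a%:C :> R[i].
  by apply/eqP; rewrite eq_complex /= oppr0 !eqxx.
have sq : p%:C * p%:C + q%:C * q%:C = 1 :> R[i].
  by rewrite -!rmorphM -rmorphD /= -!expr2 pq.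
have [e1 e2 _ _] := expiE.
have x0 := expi_neq0 alpha; have y0 := expi_neq0 beta; have g0 := expi_neq0 gamma.
apply/unitarymxP; apply/matrixP => i j.
rewrite !mxE big_ord_recl big_ord1 !mxE/=.
by case: i => -[|[|//]] ?; case: j => -[|[|//]] ? /=;
  rewrite ?e1 ?e2 ?rmorphN ?rmorphM ?fmorphV /= ?Ec ?E ?mulr1n ?mulr0n -?sq;
  field; rewrite ?x0 ?y0 ?g0.
Qed.

Definition coin0 : unitary2 R := Unitary2 C0_unitary.

Lemma cabs_C00 : cabs (C0 0 0) = p.
Proof. by rewrite C00 cabsM cabs_expi mulr1 cabs_real gtr0_norm. Qed.

Lemma cabs_C11 : cabs (C0 1 1) = p.
Proof. by rewrite C11 cabsM cabs_expi mulr1 cabs_real gtr0_norm. Qed.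

Lemma C0_det : C0 0 0 * C0 1 1 - C0 0 1 * C0 1 0 = expi gamma.
Proof.
have [e1 e2 _ _] := expiE.
have sq : p%:C * p%:C + q%:C * q%:C = 1 :> R[i].
  by rewrite -!rmorphM -rmorphD /= -!expr2 pq.
rewrite C00 C01 C10 C11 e1 e2 -[RHS]mul1r -sq; field.
by rewrite !expi_neq0.
Qed.

Variable lambda : R[i].
Hypothesis lambda1 : cabs lambda = 1.
Let kappa := complex.Re (lambda / e).

Let l0 : lambda != 0. Proof. exact: cabs_eq1_neq0. Qed.

(** A unimodular [s] satisfies [s^2 + 1 = 2 Re(s) s]; take [s = lambda / e] and scale by
    [e ^+ 2]. *)
Lemma C0_trace : lambda ^+ 2 + expi gamma = (2 * kappa)%:C * e * lambda.
Proof.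
have [_ _ _ ->] := expiE; have e0 := expi_neq0 (gamma / 2).
have s1 : cabs (lambda / e) = 1 by rewrite cabsM cabsV lambda1 cabs_expi invr1 mulr1.
have key : (lambda / e) ^+ 2 + 1 = (2 * kappa)%:C * (lambda / e).
  rewrite /kappa; move: s1; case: (lambda / e) => u v.
  move=> /(congr1 (fun x => x ^+ 2)); rewrite sqr_cabs expr1n /= => uv.
  apply/eqP; rewrite expr2 eq_complex /=; apply/andP; split; apply/eqP; last by ring.
  by lra.
have -> : lambda ^+ 2 + e ^+ 2 = ((lambda / e) ^+ 2 + 1) * e ^+ 2 by field.
by rewrite key; field.
Qed.

Lemma C0_gap : p < `|kappa| -> cabs (coin0 0 0) + cabs (coin0 1 1) <
  cabs (coin0 0 0 * coin0 1 1 - coin0 0 1 * coin0 1 0 + lambda ^+ 2).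
Proof.
move=> pk; rewrite /= cabs_C00 cabs_C11 C0_det [X in cabs X]addrC.
rewrite C0_trace !cabsM cabs_expi lambda1 !mulr1.
by rewrite cabs_real normrM ger0_norm// mulr_natl mulr2n ltrD.
Qed.

Lemma C0_omega : C0 1 1 = omega ^+ 2 * C0 0 0.
Proof.
have [_ e2 -> eg] := expiE; rewrite C00 C11 e2 eg; field.
exact: expi_neq0.
Qed.

Lemma C0_elliptic : lambda ^+ 2 + (C0 0 0 * C0 1 1 - C0 0 1 * C0 1 0) =
  (2 * (kappa / p))%:C * omega * C0 0 0 * lambda.
Proof.
have [_ _ -> _] := expiE; rewrite C0_det C0_trace C00.
have -> : 2 * kappa = 2 * (kappa / p) * p by rewrite -mulrA divfK// gt_eqF.
by move: (kappa / p) => K; rewrite rmorphM /=; field; exact: expi_neq0.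
Qed.

(** The phase [z = omega zeta], with [Re zeta = kappa / p], solves the characteristic equation. The
    first wave equation suggests [v], and the second is then the characteristic equation. *)
Lemma C0_plane_wave : `|kappa| < p -> exists z (v : 'cV[R[i]]_2),
  [/\ cabs z = 1, v != 0,
      z * (C0 0 0 * v 0 0 + C0 0 1 * v 1 0) = lambda * v 0 0 &
      C0 1 0 * v 0 0 + C0 1 1 * v 1 0 = lambda * z * v 1 0].
Proof.
move=> kp.
(* For [q = 0] the coin is diagonal and the general formula for [v] could vanish; a wave in
   component 0 is used instead. *)
have [q0|q0] := eqVneq q 0.
  have p1 : p = 1.
    by move: pq p_gt0; rewrite q0 expr0n addr0 => /eqP; rewrite sqrf_eq1 => /orP[/eqP->|/eqP->]//; lra.
  have a0 : C0 0 0 != 0 by rewrite -cabs_eq0 cabs_C00 gt_eqF.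
  exists (lambda / C0 0 0), (\col_i (if i == 0 then 1 else 0)); split.
  - by rewrite cabsM cabsV lambda1 cabs_C00 p1 invr1 mulr1.
  - apply/eqP => /matrixP/(_ 0 0); rewrite !mxE /= => /eqP.
    by rewrite oner_eq0.
  - by rewrite [in LHS]C01 q0 !mxE /= !mulr0 addr0 mulr1 mulr1 -(C00) divfK.
  - by rewrite C10 q0 !mxE /= mul0r oppr0 !mul0r !mulr0 addr0.
pose k := acos (kappa / p); pose zeta : R[i] := expi k.
have kk : cos k = kappa / p.
  have : `|kappa / p| <= 1.
    by rewrite normrM normfV (gtr0_norm p_gt0) ler_pdivrMr// mul1r ltW.
  by rewrite ler_norml => kI; rewrite /k acosK// in_itv.
have z2 : zeta ^+ 2 + 1 = (2 * (kappa / p))%:C * zeta.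
  rewrite -kk /zeta /expi.
  apply/eqP; rewrite expr2 eq_complex /=; apply/andP; split; apply/eqP; last by ring.
  by have := cos2Dsin2 k; lra.
have b0 : C0 0 1 != 0.
  by rewrite C01 mulf_neq0 ?expi_neq0// -cabs_eq0 cabs_real normr_eq0.
pose z := omega * zeta.
have z0 : z != 0 by rewrite mulf_neq0 ?expi_neq0.
exists z, (\col_i (if i == 0 then C0 0 1 * z else lambda - C0 0 0 * z)).
have char : C0 0 0 * C0 1 1 - C0 0 1 * C0 1 0 =
    (C0 0 0 * z ^+ 2 + C0 1 1) * lambda / z - lambda ^+ 2.
  apply: (addrI (lambda ^+ 2)); rewrite C0_elliptic [RHS]addrC subrK C0_omega.
  have -> : C0 0 0 * z ^+ 2 + omega ^+ 2 * C0 0 0 =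
      C0 0 0 * omega ^+ 2 * (zeta ^+ 2 + 1) by rewrite /z; ring.
  by rewrite z2 /z; field; rewrite !expi_neq0.
split.
- by rewrite cabsM !cabs_expi mulr1.
- apply/eqP => /matrixP/(_ 0 0); rewrite !mxE /= -C01 => /eqP.
  by rewrite mulf_eq0 (negbTE b0) (negbTE z0).
- rewrite [X in z * (_ * X + _)]mxE [X in z * (_ + _ * X)]mxE [in RHS]mxE /=; ring.
- rewrite [X in _ * X + _]mxE [X in _ + _ * X]mxE [in RHS]mxE /=.
  have -> : C0 1 0 * (C0 0 1 * z) = z * (C0 0 0 * C0 1 1 -
    (C0 0 0 * C0 1 1 - C0 0 1 * C0 1 0)) by ring.
  by rewrite char; field.
Qed.

End constant_coin.

(** * Exponential decay of the coin towards its limit *)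

Section decay.
Context {R : realType}.

Lemma cabs_le_mx_norm (B : 'M[R[i]]_2) (c : R) i j :
  mx_norm B <= c%:C -> cabs (B i j) <= c.
Proof.
move=> h; rewrite -lecR -cabsE; apply: le_trans h.
rewrite mx_normE -[leLHS]nngE num_le.
exact: (le_bigmax _ (fun k => `|B k.1 k.2|%:nng) (i, j)).
Qed.

Lemma normr_le_bracket (x : int) : `|x|%N%:R <= bracket x :> R.
Proof.
rewrite -ler_sqr ?nnegrE ?sqrtr_ge0// sqr_sqrtr ?addr_ge0 ?sqr_ge0//.
have -> : `|x|%N%:R = `|x%:~R| :> R by rewrite natr_absz intr_norm.
by rewrite (real_normK (num_real _)) lerDr.
Qed.

(** Since [bracket x] is at least [|x|], the ratio [r = expR (- rho)] works. *)
Lemma bracket_decay (C2 : int -> 'M[R[i]]_2) (B : 'M[R[i]]_2) :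
  (exists rho M : R, [/\ 0 < rho, 0 < M & forall x : int,
     mx_norm (C2 x - B) <= (M * expR (- rho * bracket x))%:C]) ->
  exists M r, [/\ 0 < M, 0 < r < 1 &
    forall x i j, cabs (C2 x i j - B i j) <= M * r ^+ `|x|%N].
Proof.
move=> [rho [M [rho0 M0 h]]]; exists M, (expR (- rho)); split=> //.
  by rewrite expR_gt0 expR_lt1 oppr_lt0.
move=> x i j; have -> : C2 x i j - B i j = (C2 x - B) i j by rewrite !mxE.
apply: le_trans (cabs_le_mx_norm _ _ (h x)) _.
rewrite ler_pM2l// -expRM_natr ler_expR ler_nM2l ?oppr_lt0//.
exact: normr_le_bracket.
Qed.

Lemma geometric_limit (C2 : int -> 'M[R[i]]_2) (B : 'M[R[i]]_2) (M r : R) :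
  0 < r < 1 -> (forall x i j, cabs (C2 x i j - B i j) <= M * r ^+ `|x|%N) ->
  forall e : R, 0 < e -> exists t : seq int,
    forall x, x \notin t -> forall i j, cabs (C2 x i j - B i j) <= e.
Proof.
move=> /andP[r0 r1] h e e0.
have r01 : 0 <= r < 1 by rewrite ltW.
have [k hk] := geometric_small M r01 e0.
exists ([seq j%:Z | j <- iota 0 k] ++ [seq - j%:Z | j <- iota 0 k]) => x xt i j.
apply: le_trans (h x i j) _; apply: hk; rewrite leqNgt; apply: contra xt => xk.
rewrite mem_cat; case: (leP 0 x) => x0.
  by apply/orP; left; apply/mapP; exists `|x|%N; rewrite ?mem_iota; lia.
by apply/orP; right; apply/mapP; exists `|x|%N; rewrite ?mem_iota; lia.
Qed.

End decay.

(** * The walk with defects as a shift after a position-dependent coin *)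

Section defect_walk.
Context {R : realType}.

Lemma defect_walkE (e : set int) (B : unitary2 R) (C2 : int -> unitary2 R) psi :
  walk (defect_coin e B C2) psi =
  shift_op (coin_op (fun x => if x \in e then B else C2 x) psi).
Proof.
congr shift_op; apply: hilbP => x.
rewrite -[LHS]/(restr_fun e (coin_fun (fun=> B) psi) x +
  (coin_fun C2 psi x - restr_fun e (coin_fun C2 psi) x)).
rewrite /restr_fun /= /coin_fun; case: (x \in e).
  by rewrite subrr addr0.
by rewrite subr0 add0r.
Qed.

(** The defect is finite, so enlarging the exceptional set keeps the limit of the coin at
    infinity. *)
Lemma edges_notin (N : nat) (y : 'I_N -> int) (t : seq int) :
  exists2 t' : seq int, {subset t <= t'} & forall x, x \notin t' -> (x \in edges y) = false.
Proof.
exists (t ++ [seq y j - 1 | j <- enum 'I_N] ++ [seq y j | j <- enum 'I_N]).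
  by move=> x xt; rewrite mem_cat xt.
move=> x; rewrite !mem_cat !negb_or => /and3P[_ h1 h2].
apply/negbTE; apply/negP; rewrite inE => -[j _ [xy|xy]].
  by case/negP: h1; apply/mapP; exists j; rewrite ?mem_enum.
by case/negP: h2; apply/mapP; exists j; rewrite ?mem_enum.
Qed.

End defect_walk.

(** * No defect: the three positions of [lambda] relative to the bands *)

Section no_defect.
Context {R : realType}.
Variables (p q alpha beta gamma : R) (C2 : int -> unitary2 R).
Variable U : {linear hilb R -> hilb R}.
Hypothesis UE : forall psi, U psi = shift_op (coin_op C2 psi).
Hypothesis p01 : 0 < p <= 1.
Hypothesis pq : p ^+ 2 + q ^+ 2 = 1.
Variables (delta M r : R).
Hypothesis delta0 : 0 < delta.
Hypothesis C2_ge : forall x, delta <= cabs (C2 x 0 0).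
Hypothesis M0 : 0 < M.
Hypothesis r01 : 0 < r < 1.
Hypothesis C2_decay : forall x i j,
  cabs (C2 x i j - C0 p q alpha beta gamma i j) <= M * r ^+ `|x|%N.

(** For [|kappa| < p] the eigenfunction vanishes; for [|kappa| > p] the eigenvalue is discrete,
    hence outside [ess_spectrum U]; for [|kappa| = p] it is a threshold. *)
Lemma no_defect_no_eigenvalue lambda :
  (ess_spectrum U `\` thresholds p gamma U) lambda -> ~ is_eigenvalue U lambda.
Proof.
move=> [ess nthr] eig.
have l1 := spectrum_unit (walk_isometry UE) (walk_surj UE) ess.1.
have p0 : 0 < p by case/andP: p01.
have p01' : 0 <= p <= 1 by case/andP: p01 => /ltW ->.
set kappa := complex.Re (lambda / expi (gamma / 2)).
case: (ltgtP `|kappa| p) => kp.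
- case: eig => psi psi0 e; case/eqP: psi0.
  have t1 : `|kappa / p| < 1.
    by rewrite normrM normfV (gtr0_norm p0) ltr_pdivrMr// mul1r.
  apply: (eigenvector_decay_eq0 UE l1 (cabs_expi _) t1 delta0 C2_ge _
    (C0_omega p q alpha beta gamma) (C0_elliptic alpha beta gamma p01 pq l1) M0 r01 _ e).
    by rewrite -cabs_eq0 (cabs_C00 q alpha beta gamma p01) gt_eqF.
  by move=> k i j; exact: (C2_decay k%:Z).
- apply: ess.2.
  pose A0 := coin0 alpha beta gamma pq.
  pose U0 : {linear hilb R -> hilb R} := walk (coin_op (fun=> A0)).
  apply: (@gap_discrete _ A0 U0 _ lambda l1 C2 U UE _ delta0 C2_ge) => //.
  - exact: (geometric_limit r01 C2_decay).
  - exact: C0_gap.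
- have s1 : cabs (lambda / expi (gamma / 2)) = 1.
    by rewrite cabsM cabsV l1 cabs_expi invr1 mulr1.
  have [phi hphi e] := expi_thresholds p01' s1 kp.
  apply: nthr; split=> //; exists (phi + gamma / 2).
    move: hphi; rewrite /J_T /=.
    by move=> [[[->|->]|->]|->]; [do 3!left|do 2!left; right|left; right|right].
  by rewrite expiD -e divfK ?expi_neq0.
Qed.

End no_defect.

(** * With defects: the bands still belong to the essential spectrum *)

Section defect.
Context {R : realType}.
Variables (p q alpha beta gamma theta : R) (A : int -> unitary2 R).
Variable U : {linear hilb R -> hilb R}.
Hypothesis UE : forall psi, U psi = shift_op (coin_op A psi).
Hypothesis p01 : 0 < p <= 1.
Hypothesis pq : p ^+ 2 + q ^+ 2 = 1.
Hypothesis A_lim : forall e : R, 0 < e -> exists t : seq int,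
  forall x, x \notin t -> forall i j,
    cabs (A x i j - C0 p q alpha beta gamma i j) <= e.

Lemma Re_expi_div (s : R) : complex.Re (expi s / expi (gamma / 2)) = cos (s - gamma / 2).
Proof. by rewrite -expiN -expiD. Qed.

Lemma band_spectrum (s : R) : `|cos (s - gamma / 2)| < p -> spectrum U (expi s).
Proof.
rewrite -Re_expi_div => sp.
pose A0 := coin0 alpha beta gamma pq.
pose U0 : {linear hilb R -> hilb R} := walk (coin_op (fun=> A0)).
have [z [v [z1 v0 w0 w1]]] :=
  C0_plane_wave alpha beta p01 pq (cabs_expi s) sp.
exact: (@plane_wave_spectrum _ A0 U0 _ (expi s) z v (cabs_expi s) z1 v0 w0 w1 A U UE A_lim).
Qed.

(** A small rotation stays in the open band and yields another spectral point arbitrarily close. *)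
Lemma band_not_isolated : `|cos (theta - gamma / 2)| < p ->
  ~ isolated (spectrum U) (expi theta).
Proof.
move=> tp /isolatedP[_ [e e0 h]].
have eE : e = (complex.Re e)%:C.
  by move: e0; case: e {h} => a b; rewrite ltcE /= => /andP[/eqP-> _].
have e0' : 0 < complex.Re e by rewrite -ltcR -eE.
have [x [xp x1 xe]] := small_rotation tp e0'.
have : expi (theta + x) = expi theta.
  apply: h.
    by apply: band_spectrum; rewrite addrAC.
  rewrite expiD -[X in _ - X]mulr1 -mulrBr cabsE cabsM cabs_expi mul1r eE.
  by rewrite ltcR.
rewrite expiD -[RHS]mulr1 => /(mulfI (expi_neq0 theta))/eqP.
by rewrite (negbTE x1).
Qed.

Lemma band_ess_spectrum : (J p gamma `\` J_T p gamma) theta ->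
  is_eigenvalue U (expi theta) ->
  (ess_spectrum U `\` thresholds p gamma U) (expi theta).
Proof.
move=> hJ eig.
have p01' : 0 <= p <= 1 by case/andP: p01 => /ltW ->.
have band := cos_interior_J p01' hJ.
have [ca a0 api] := acos_unit p01'.
split; first split.
- exact: (eigenvalue_spectrum (walk_isometry UE) (walk_surj UE)).
- by move=> [iso _ _]; exact: band_not_isolated iso.
- move=> [[phi hphi e] _].
  (* This cosine depends only on the point [expi phi], so the comparison is valid although [J_T] is
     not taken modulo [2 * pi]. *)
  have : `|cos (phi - gamma / 2)| = p.
    have pn : `|p| = p by rewrite ger0_norm//; case/andP: p01'.
    have pi2 : 2 * pi = pi + pi :> R by ring.
    case: hphi => [[[->|->]|->]|->]; rewrite addrK.
    + by rewrite ca.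
    + by rewrite cos_piB ca normrN.
    + by rewrite addrC cosDpi ca normrN.
    + by rewrite pi2 -addrA [pi + _]addrC cosDpi cos_piB opprK ca.
  rewrite -Re_expi_div e Re_expi_div => ep.
  by move: band; rewrite ep ltxx.
Qed.

End defect.

(** * Defects characterized by embedded eigenvalues *)

Theorem corollary1p4 (R : realType)
  (p q alpha beta gamma beta' gamma' : R)
  (C2 : int -> unitary2 R) (N : nat) (y : 'I_N -> int)
  (hp : 0 < p <= 1) (hq : 0 <= q <= 1) (hpq : p ^+ 2 + q ^+ 2 = 1)
  (halpha : 0 <= alpha < 2 * pi) (hbeta : 0 <= beta < 2 * pi)
  (hgamma : 0 <= gamma < 2 * pi)
  (hbeta' : 0 <= beta' < 2 * pi) (hgamma' : 0 <= gamma' < 2 * pi)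
  (hJ : (J p gamma `\` J_T p gamma) ((gamma' + pi) / 2))
  (hdecay : exists rho M : R, [/\ 0 < rho, 0 < M &
     forall x : int, mx_norm (unitary2_mx (C2 x) - C0 p q alpha beta gamma) <=
                     (M * expR (- rho * bracket x))%:C])
  (ha : exists2 delta : R, 0 < delta & forall x : int, delta%:C <= `|C2 x 0 0|) :
  let e := edges y in
  let U := walk (defect_coin e (C1 beta' gamma') C2) in
  e = set0 <->
  ~ (exists2 lambda : R[i],
       (ess_spectrum U `\` thresholds p gamma U) lambda & is_eigenvalue U lambda).
Proof.
move=> e U; have [M [r [M0 r01 C2_decay]]] := bracket_decay hdecay.
have [delta delta0 C2_ge] := ha.
split=> [e0 [lambda hl]|noeig].
  apply: (no_defect_no_eigenvalue _ hp hpq delta0 _ M0 r01 C2_decay hl).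
    move=> psi; rewrite /U defect_walkE; congr shift_op; apply: hilbP => x.
    by rewrite /= /coin_fun e0 in_set0.
  by move=> x; rewrite -lecR -cabsE.
apply/eqP; apply: contrapT => /negP/set0P[x [j _ _]]; apply: noeig.
pose A x := if x \in e then C1 beta' gamma' else C2 x.
have UE psi : U psi = shift_op (coin_op A psi) by exact: defect_walkE.
have A_lim (eps : R) : 0 < eps -> exists t : seq int,
    forall x, x \notin t -> forall i j,
      cabs (A x i j - C0 p q alpha beta gamma i j) <= eps.
  move=> eps0; have [t ht] := geometric_limit r01 C2_decay eps0.
  have [t' tt' ht'] := edges_notin y t.
  exists t' => z zt i k; rewrite /A /e ht'//; apply: ht.
  by apply: contra zt; exact: tt'.
have eig : is_eigenvalue U (expi ((gamma' + pi) / 2)).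
  have Ay z : z \in [set y j - 1; y j] -> A z = C1 beta' gamma'.
    move=> zj; rewrite /A ifT//; rewrite inE; exists j => //.
    by move: zj; rewrite inE.
  have A1 : A (y j - 1) = C1 beta' gamma' by apply: Ay; rewrite inE; left.
  have A2 : A (y j) = C1 beta' gamma' by apply: Ay; rewrite inE; right.
  apply: (localized_eigenvalue UE (y := y j)); rewrite ?A1 ?A2 ?expi_neq0//.
  - by rewrite !mxE /= mulr0.
  - by rewrite !mxE /= mulr0.
  (* The off-diagonal entries of [C1] multiply to [- expi gamma'], which is [expi (gamma' + pi)],
     the square of the candidate. *)
  rewrite !mxE /= expr2 -expiD mulrN mulrN -!expiD.
  rewrite (_ : gamma' / 2 + _ + _ = gamma'); last by field.
  rewrite (_ : (gamma' + pi) / 2 + _ = gamma' + pi); last by field.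
  rewrite expiD (_ : expi pi = -1) ?mulrN1//.
  by apply/eqP; rewrite eq_complex /= cospi sinpi oppr0 !eqxx.
exists (expi ((gamma' + pi) / 2)) => //.
exact: (band_ess_spectrum UE hp hpq A_lim).
Qed.
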